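(* Let $n\ge2$. The set $\{C_\lambda : \lambda \text{ a partition of } n\}$ is a basis for the matrix algebra $\mathbb{A}$. The change-of-basis equations with respect to the matrices $A_\alpha$ have the form $$C_\lambda=\sum_{\alpha\unlhd\lambda} m_{\lambda,\alpha}A_\alpha$$ with $m_{\lambda,\lambda}>0$. The change-of-basis equations with respect to the matrices $E_\mu$ have the form $$C_\lambda=\sum_{\mu\unrhd\lambda} n_{\lambda,\mu}E_\mu$$ with $n_{\lambda,\mu}\ne0$ for all $\mu\unrhd\lambda$.
   Context: $\Omega=\{1,\dots,n\}$, $S_n=\mathrm{Sym}(\Omega)$; $\lambda,\alpha,\mu$ range over integer partitions of $n$. For $g\in S_n$, $A(g)$ is the $n!\times n!$ real permutation matrix of the left regular representation (rows and columns indexed by $S_n$, with $(a,b)$-entry $1$ iff $ab^{-1}=g$). For the conjugacy class $\mathcal{C}_\alpha$ of permutations of cycle type $\alpha$, $A_\alpha=\sum_{g\in\mathcal{C}_\alpha}A(g)$. $\mathbb{A}$ is the real span of the $A_\alpha$, i.e. the center of the group algebra of $S_n$ in the left regular representation. For each $\mu$, $E_\mu=\frac{f_\mu}{n!}\sum_\alpha\chi^\mu_\alpha A_\alpha$, where $\chi^\mu$ is the irreducible character of $S_n$ indexed by $\mu$, $f_\mu$ its degree, and $\chi^\mu_\alpha$ its value on $\mathcal{C}_\alpha$; the $E_\mu$ are the primitive idempotents of $\mathbb{A}$. An ordered set partition of $\Omega$ of shape $\lambda=(\lambda_1\ge\dots\ge\lambda_k)$ is a tuple $P=(P_1,\dots,P_k)$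 of pairwise disjoint subsets with union $\Omega$ and $|P_i|=\lambda_i$; its Young subgroup $Y_P$ (said to have shape $\lambda$) consists of all permutations fixing each $P_i$ setwise. $Y_\lambda$ is the $0$-$1$ incidence matrix with rows indexed by $S_n$ and columns indexed by all left cosets $hY_P$ of all Young subgroups of shape $\lambda$, with $(g,hY_P)$-entry $1$ iff $g\in hY_P$. $C_\lambda=Y_\lambda Y_\lambda^\top$. Dominance order: $\lambda\unlhd\mu$ (equivalently $\mu\unrhd\lambda$) iff $\sum_{i=1}^j\lambda_i\le\sum_{i=1}^j\mu_i$ for all $j$ (missing parts are $0$). *)

(* Defs.v *)
From HB Require Import structures.
From mathcomp Require Import all_boot all_order all_algebra.
From mathcomp Require Import all_fingroup all_character.
From mathcomp Require Import reals.

Set Implicit Arguments.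
Unset Strict Implicit.
Unset Printing Implicit Defensive.

Import GRing.Theory.
Local Open Scope ring_scope.

(* The set {1, ..., n} is 'I_n, and permutations are multiplied with the      *)
(* MathComp convention (s * t) x = t (s x).                                   *)

(* A partition of n is padded with zeros to length exactly n: this makes the  *)
(* partitions of n a finType and sets the missing parts to 0.                 *)
Definition is_intpart n (f : {ffun 'I_n -> 'I_n.+1}) : bool :=
  [forall i : 'I_n, forall j : 'I_n, (i <= j)%N ==> (f j <= f i)%N] &&
  (\sum_i (f i : nat) == n)%N.

Record intpart (n : nat) := IntPart {
  parts :> {ffun 'I_n -> 'I_n.+1};
  _ : is_intpart parts
}.

HB.instance Definition _ n := [isSub for @parts n].
HB.instance Definition _ n := [Countable of intpart n by <:].
HB.instance Definition _ n := [Finite of intpart n by <:].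

Definition psum n (lam : intpart n) (j : nat) : nat :=
  (\sum_(i < n | (i < j)%N) lam i)%N.

(* For j >= n both partial sums are n, so j <= n suffices. *)
Definition dominated n (lam mu : intpart n) : bool :=
  [forall j : 'I_n.+1, psum lam j <= psum mu j]%N.

(* The permutations whose cycle lengths (fixed points included) are, up to    *)
(* order, the nonzero parts of alpha.                                         *)
Definition cycle_class n (alpha : intpart n) : {set 'S_n} :=
  [set g : 'S_n | perm_eq [seq #|pred_of_set X| | X in porbits g]
                          [seq k <- [seq (alpha i : nat) | i : 'I_n] | (0 < k)%N]].

(* Blocks beyond the last nonzero part of lam are forced to be empty. *)
Definition is_ordered_set_partition n (lam : intpart n)
    (P : {ffun 'I_n -> {set 'I_n}}) : bool :=
  [&& [forall i : 'I_n, forall j : 'I_n, (i != j) ==> [disjoint P i & P j]],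
      \bigcup_i P i == setT & [forall i, #|P i| == lam i :> nat]].

Definition young_subgroup n (P : {ffun 'I_n -> {set 'I_n}}) : {set 'S_n} :=
  [set g : 'S_n | [forall i, (g @: P i) == P i]].

(* A set of subsets of S_n: ordered set partitions with the same Young        *)
(* subgroup contribute the same cosets, which are counted once.               *)
Definition young_cosets n (lam : intpart n) : {set {set 'S_n}} :=
  [set (h *: young_subgroup P)%g | h : 'S_n,
     P : {ffun 'I_n -> {set 'I_n}} in is_ordered_set_partition lam].

Section Matrices.
Variables (R : realType) (n : nat).

Definition Amx (g : 'S_n) : 'M[R]_#|[set: 'S_n]| :=
  \matrix_(i, j) ((enum_val i * (enum_val j)^-1)%g == g)%:R.

Definition Aclass (alpha : intpart n) : 'M[R]_#|[set: 'S_n]| :=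
  \sum_(g in cycle_class alpha) Amx g.

Definition Aalg : {vspace 'M[R]_#|[set: 'S_n]|} :=
  <<[seq Aclass alpha | alpha : intpart n]>>%VS.

Definition Ymx (lam : intpart n) :
    'M[R]_(#|[set: 'S_n]|, #|young_cosets lam|) :=
  \matrix_(i, j) ((enum_val i : 'S_n) \in (enum_val j : {set 'S_n}))%:R.

Definition Cmx (lam : intpart n) : 'M[R]_#|[set: 'S_n]| :=
  Ymx lam *m (Ymx lam)^T.

End Matrices.

(* The irreducible character indexed by mu is the character of the Specht     *)
(* module V_mu = k[S_n] c_mu, where c_mu = a_mu b_mu is the Young symmetrizer *)
(* of the tableau of shape mu filled row by row with 0, ..., n-1.             *)

Definition tab_row n (mu : intpart n) (x : 'I_n) : nat :=
  #|[set i : 'I_n | psum mu i.+1 <= x]%N|.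

Definition tab_col n (mu : intpart n) (x : 'I_n) : nat :=
  (x - psum mu (tab_row mu x))%N.

Definition row_group n (mu : intpart n) : {set 'S_n} :=
  [set p : 'S_n | [forall x, tab_row mu (p x) == tab_row mu x]].

Definition col_group n (mu : intpart n) : {set 'S_n} :=
  [set q : 'S_n | [forall x, tab_col mu (q x) == tab_col mu x]].

Section Specht.
Variables (F : fieldType) (n : nat) (mu : intpart n).

Let G : {group 'S_n} := [set: 'S_n]%G.

(* The product q * p is the composite of q followed by p, so this is the      *)
(* usual sum of sgn(q) pq over row permutations p and column permutations q.  *)
Definition young_symmetrizer : 'rV[F]_#|G| :=
  \sum_(p in row_group mu) \sum_(q in col_group mu)
    (-1) ^+ (q : bool) *: delta_mx 0 (gring_index G (q * p)%g).

(* MathComp representations act on row vectors from the right; with its       *)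
(* product of permutations this right ideal is the left ideal k[S_n] c_mu for *)
(* the composition of functions.                                              *)
Definition specht_mx : 'M[F]_#|G| :=
  cyclic_mx (regular_repr F G) young_symmetrizer.

Definition specht_repr : mx_representation F G (\rank specht_mx) :=
  submod_repr (cyclic_mx_module (regular_repr F G) young_symmetrizer).

Definition specht_char (g : 'S_n) : F := \tr (specht_repr g).

Definition specht_degree : nat := \rank specht_mx.

End Specht.

(* The Specht modules are defined over the rationals, so their characters     *)
(* have the same values over the reals as over the complex numbers; the value *)
(* on a class is read off at a representative.                                *)
Definition Emx (R : realType) n (mu : intpart n) : 'M[R]_#|[set: 'S_n]| :=
  ((specht_degree R mu)%:R / (n`!)%:R) *:
    \sum_alpha specht_char R mu (repr (cycle_class alpha)) *: Aclass R alpha.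

(* Main.v *)
Require Import Defs.
From mathcomp Require Import all_boot all_order all_algebra.
From mathcomp Require Import all_fingroup all_character.
From mathcomp Require Import reals.

Set Implicit Arguments.
Unset Strict Implicit.
Unset Printing Implicit Defensive.
Import GRing.Theory.
Local Open Scope ring_scope.

(** Two elements a and b of the symmetric group lie in a common left coset of
    a Young subgroup Y exactly when a^-1 b is in Y.  Hence the (a, b) entry of
    C_lam is the number of Young subgroups of shape lam that contain a^-1 b.
    An ordered set partition of shape lam is a word of content lam (the letter
    at x is the index of the block of x), its Young subgroup is the stabilizer
    of the word, and each Young subgroup comes from the same number of words.
    So, up to a positive factor, C_lam is the permutation character psi^lam of
    the symmetric group on the words of content lam, read at a^-1 b, or
    equivalently at a b^-1, which is conjugate to the inverse of a^-1 b
    [Cmx_class_sum].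

    Reading psi^lam on the classes gives the expansion in the A_alpha.  If a
    permutation of cycle type alpha fixes a word of content lam, its cycles are
    merged into the blocks of the word, which forces alpha to be dominated by
    lam [dominated_of_fix]; the permutation that cycles each row of the tableau
    of shape lam fixes the row word, so the diagonal coefficient is positive.
    This triangularity makes the C_lam a basis of the span of the A_alpha.

    The expansion in the E_mu says that psi^lam is a combination of the
    Specht characters chi^mu with mu dominating lam, all with nonzero
    coefficients: a weak form of Young's rule.  By Maschke's theorem the right
    ideal c_mu A generated by the Young symmetrizer c_mu contains an element e
    acting on it as a left identity.  The trace formula for this ideal turns
    the pairing of chi^mu with the trace of rho(g) M, where M is an idempotent
    commuting with the representation rho, into n! times the rank of rho(e) M,
    so the pairing vanishes exactly when rho(c_mu) M does
    [cyclic_character_pairing_eq0].  This is used twice.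

    - With rho a Specht module: the column antisymmetrizer of mu kills every
      word in which some column of mu carries a repeated letter, and a word of
      content nu without such a repetition exists only if nu is dominated by
      mu.  For mu <> nu this applies to one of the two orders, so the Specht
      characters are orthogonal.  There are as many of them as classes, and
      they are nonzero, so they form a basis of the class functions.

    - With rho the space of words and M the projection on content lam: the
      pairing of psi^lam and chi^mu vanishes, for the reason just given, unless
      lam is dominated by mu.  Conversely c_mu does not vanish on the words of
      content mu [word_young_diag].  The operator that changes one letter i into
      j commutes with the symmetric group, and it is injective on words with
      more letters i than j, by the commutation relation of sl_2 and the
      positivity of sums of squares [move_mx_inj].  Applying such operators
      leads from content mu to any lam dominated by mu [dominance_ind], so
      c_mu does not vanish there either. *)

(** * Partial sums, the row tableau and words *)

Section Tableau.
Variable n : nat.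
Implicit Types (mu lam nu : intpart n) (x y : 'I_n).

Lemma parts_nonincr mu (i j : 'I_n) : (i <= j)%N -> (mu j <= mu i)%N.
Proof. by case: mu => f /= /andP[/forallP/(_ i)/forallP/(_ j)/implyP h _]. Qed.

Lemma parts_sum mu : (\sum_i (mu i : nat))%N = n.
Proof. by case: mu => f /= /andP[_ /eqP]. Qed.

Lemma psum0 mu : psum mu 0 = 0%N.
Proof. by rewrite /psum big_pred0. Qed.

Lemma psumS mu (i : 'I_n) : psum mu i.+1 = (psum mu i + mu i)%N.
Proof.
rewrite /psum (bigD1 i) //= addnC; congr (_ + _)%N.
by apply: eq_bigl => j; rewrite ltnS [(j < i)%N]ltn_neqAle andbC -val_eqE.
Qed.

Lemma psum_all mu j : (n <= j)%N -> psum mu j = n.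
Proof.
move=> h; rewrite -[RHS](parts_sum mu) /psum; apply: eq_bigl => i.
by rewrite (leq_trans (ltn_ord i) h).
Qed.

Lemma psum_mono mu i j : (i <= j)%N -> (psum mu i <= psum mu j)%N.
Proof.
move=> h; rewrite /psum [leqRHS](bigID (fun k : 'I_n => (k < i)%N)) /=.
apply: leq_trans (leq_addr _ _); apply/eq_leq/eq_bigl => k.
by case: ltnP => hk; rewrite ?andbF // (leq_trans hk h).
Qed.

Lemma dominatedP lam mu :
  reflect (forall j, psum lam j <= psum mu j)%N (dominated lam mu).
Proof.
apply: (iffP forallP) => [h j|h j]; last exact: h.
case: (ltnP j n.+1) => hj; first exact: (h (Ordinal hj)).
by rewrite !psum_all // ltnW.
Qed.

Lemma dominated_refl lam : dominated lam lam.
Proof. by apply/dominatedP. Qed.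

Lemma dominated_trans lam mu nu :
  dominated lam mu -> dominated mu nu -> dominated lam nu.
Proof.
by move=> /dominatedP h1 /dominatedP h2; apply/dominatedP=> j; apply: leq_trans (h1 j) (h2 j).
Qed.

Lemma dominated_anti lam mu : dominated lam mu -> dominated mu lam -> lam = mu.
Proof.
move=> /dominatedP h1 /dominatedP h2.
have e j : psum lam j = psum mu j by apply/eqP; rewrite eqn_leq h1 h2.
apply/val_inj/ffunP => i; apply: val_inj => /=.
by move: (psumS lam i) (psumS mu i); rewrite !e => -> /addnI.
Qed.

Lemma card_ord_lt j : (j <= n)%N -> #|[set i : 'I_n | (i < j)%N]| = j.
Proof.
move=> hj; rewrite -sum1dep_card -(big_ord_widen_cond n xpredT (fun=> 1%N)) //.
by rewrite sum1_card card_ord.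
Qed.

(** Turns the count that defines [tab_row] into the usual position of x between
    two consecutive partial sums. *)
Lemma tab_rowP mu x (r : 'I_n) :
  (psum mu r <= x < psum mu r.+1)%N -> tab_row mu x = r.
Proof.
case/andP=> h1 h2; rewrite /tab_row.
transitivity #|[set i : 'I_n | (i < r)%N]|.
  congr #|pred_of_set _|; apply/setP=> i; rewrite !inE.
  apply/idP/idP => [h|hi]; last exact: leq_trans (psum_mono mu hi) h1.
  rewrite ltnNge; apply/negP => hri.
  by have := leq_trans h2 (leq_trans (psum_mono mu (hri : r.+1 <= i.+1)%N) h); rewrite ltnn.
exact: card_ord_lt (ltnW (ltn_ord r)).
Qed.

Lemma tab_row_ex mu x : exists2 r : 'I_n, tab_row mu x = r &
  (psum mu r <= x < psum mu r.+1)%N.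
Proof.
have ex : exists i, (x < psum mu i.+1)%N.
  by exists n; rewrite psum_all.
case: (ex_minnP ex) => r hr hm.
have rn : (r < n)%N.
  have n0 : (0 < n)%N := leq_ltn_trans (leq0n _) (ltn_ord x).
  rewrite -(prednK n0) ltnS; apply: hm; rewrite prednK // psum_all //.
suff h : (psum mu r <= x < psum mu r.+1)%N.
  by exists (Ordinal rn) => //; apply: (@tab_rowP _ _ (Ordinal rn)).
rewrite hr andbT; case: r hm {hr rn} => [|r] hm; first by rewrite psum0.
by rewrite leqNgt; apply/negP => /hm; rewrite ltnn.
Qed.

(** Stays in 'I_n; the default x is never reached, since each x lies in some
    row. *)
Definition row_word mu : {ffun 'I_n -> 'I_n} :=
  [ffun x => odflt x (insub (tab_row mu x))].

Lemma row_wordE mu x : row_word mu x = tab_row mu x :> nat.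
Proof. by rewrite ffunE; have [r -> _] := tab_row_ex mu x; rewrite valK. Qed.

Lemma tab_row_bounds mu x :
  (psum mu (row_word mu x) <= x < psum mu (row_word mu x).+1)%N.
Proof. by rewrite row_wordE; have [r -> h] := tab_row_ex mu x. Qed.

Lemma tab_colE mu x : (x = psum mu (row_word mu x) + tab_col mu x :> nat)%N.
Proof.
rewrite /tab_col -row_wordE subnKC //.
by case/andP: (tab_row_bounds mu x).
Qed.

Lemma tab_col_lt mu x : (tab_col mu x < mu (row_word mu x))%N.
Proof.
case/andP: (tab_row_bounds mu x) => _.
by rewrite {1}(tab_colE mu x) psumS ltn_add2l.
Qed.

Lemma tab_inj mu x y :
  row_word mu x = row_word mu y -> tab_col mu x = tab_col mu y -> x = y.
Proof. by move=> h1 h2; apply: val_inj; rewrite /= (tab_colE mu x) (tab_colE mu y) h1 h2. Qed.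

Lemma tab_cell mu (i : 'I_n) c : (c < mu i)%N ->
  exists2 x, row_word mu x = i & tab_col mu x = c.
Proof.
move=> hc; have hx : (psum mu i + c < n)%N.
  rewrite -[leqRHS](psum_all mu (leqnn n)).
  apply: leq_trans (psum_mono mu (ltn_ord i)).
  by rewrite psumS ltn_add2l.
have hr : row_word mu (Ordinal hx) = i.
  by apply: val_inj; rewrite /= row_wordE (@tab_rowP _ _ i) //= leq_addr psumS ltn_add2l.
exists (Ordinal hx) => //; have := tab_colE mu (Ordinal hx); rewrite hr /=.
by move/addnI.
Qed.

Definition content (w : {ffun 'I_n -> 'I_n}) (i : 'I_n) := #|[set x | w x == i]|.

Definition has_weight (k : 'I_n -> nat) (w : {ffun 'I_n -> 'I_n}) :=
  [forall i, content w i == k i].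

Definition has_content mu w := has_weight (fun i => mu i) w.

Lemma has_contentP mu w :
  reflect (forall i, content w i = mu i) (has_content mu w).
Proof. by apply: (iffP forallP) => h i; apply/eqP; [exact: h|rewrite h]. Qed.

Lemma content_row_word mu : has_content mu (row_word mu).
Proof.
apply/has_contentP => i.
rewrite /content.
have inj : {in [set x | row_word mu x == i] &, injective (tab_col mu)}.
  move=> x y; rewrite !inE => /eqP hx /eqP hy; apply: tab_inj.
  by rewrite hx hy.
rewrite cardE -(size_map (tab_col mu)) -[RHS](size_iota 0).
apply/eqP; rewrite -uniq_size_uniq ?iota_uniq //.
- rewrite map_inj_in_uniq ?enum_uniq // => x y; rewrite !mem_enum; exact: inj.
- move=> c; rewrite mem_iota add0n leq0n /=; apply/idP/mapP.
  + by move=> /tab_cell[x /eqP h <-]; exists x; rewrite ?mem_enum ?inE.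
  + by case=> x; rewrite mem_enum inE => /eqP <- ->; apply: tab_col_lt.
Qed.

Lemma psum_content lam w j : has_content lam w ->
  psum lam j = #|[set x | (w x < j)%N]|.
Proof.
move/has_contentP => h; rewrite /psum -sum1dep_card.
rewrite [RHS](partition_big w (fun i : 'I_n => (i < j)%N)) //=.
apply: eq_bigr => i hi; rewrite -h /content -sum1dep_card.
by apply: eq_bigl => x; case: eqP => [->|]; rewrite ?andbF ?hi.
Qed.

(** The first j parts are the largest ones: outside the common indices, every
    part of S is at most lam_j and every one of the replaced parts is at
    least lam_j. *)
Lemma sum_parts_le lam (S : {set 'I_n}) j : (#|S| <= j)%N ->
  (\sum_(i in S) lam i <= psum lam j)%N.
Proof.
move=> hS; case: (ltnP j n) => hj; last first.
  rewrite psum_all // -[leqRHS](parts_sum lam) [leqRHS](bigID (mem S)) /=.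
  exact: leq_addr.
pose J : {set 'I_n} := [set i : 'I_n | (i < j)%N]; pose k := Ordinal hj.
have cJ : #|J| = j := card_ord_lt (ltnW hj).
have -> : psum lam j = (\sum_(i in J) lam i)%N by apply: eq_bigl => i; rewrite inE.
rewrite (big_setID J) [leqRHS](big_setID S) /= setIC leq_add2l.
(* Every part outside J is at most lam k, every part inside at least lam k. *)
apply: (@leq_trans (#|S :\: J| * lam k)).
  rewrite -sum_nat_const; apply: leq_sum => i; rewrite !inE -leqNgt => /andP[h _].
  exact: parts_nonincr.
apply: (@leq_trans (#|J :\: S| * lam k)).
  rewrite leq_mul2r; apply/orP; right.
  have := cardsID J S; have := cardsID S J; rewrite setIC => e1 e2.
  by rewrite -(leq_add2l #|S :&: J|) e1 e2 cJ.
rewrite -sum_nat_const; apply: leq_sum => i; rewrite !inE => /andP[_ h].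
by apply: parts_nonincr; apply: ltnW.
Qed.

(** The easy half of the Gale-Ryser theorem.  In column c of the tableau, a word
    that is injective there has at most j letters below j, and at most as many as
    the column has cells; the first j rows contain exactly the minimum of these
    two numbers of cells of that column. *)
Lemma dominated_col_inj nu mu w : has_content nu w ->
  (forall x y, w x = w y -> tab_col mu x = tab_col mu y -> x = y) ->
  dominated nu mu.
Proof.
move=> hw inj; apply/dominatedP => j.
rewrite (psum_content j hw) (psum_content j (content_row_word mu)).
pose col x : 'I_n.+1 := inord (tab_col mu x).
have colE x : col x = tab_col mu x :> nat.
  by rewrite inordK // (leq_trans (tab_col_lt mu x)) // -ltnS ltnS ltnW.
have part (f : 'I_n -> 'I_n) : #|[set x | (f x < j)%N]| =
    (\sum_(c : 'I_n.+1) #|[set x | (f x < j)%N && (col x == c)]|)%N.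
  rewrite -sum1dep_card (partition_big col xpredT) //=.
  by apply: eq_bigr => c _; rewrite sum1dep_card.
rewrite !part; apply: leq_sum => c _.
(* Either column c ends above row j, or it meets all of the first j rows. *)
case: (altP (@forallP _ (fun x : 'I_n => (col x == c) ==> (row_word mu x < j)%N))) => [hall|].
  apply: subset_leq_card; apply/subsetP => x; rewrite !inE => /andP[_ hc].
  by rewrite hc andbT; have /implyP := hall x; apply.
case/forallPn => x0; rewrite negb_imply -leqNgt => /andP[/eqP hc hj].
have hjn : (j <= n)%N by rewrite (leq_trans hj) // ltnW.
have cJ := card_ord_lt hjn.
apply: (@leq_trans j).
  rewrite -[leqRHS]cJ -(@card_in_imset _ _ w) ; last first.
    move=> x y; rewrite !inE => /andP[_ /eqP hx] /andP[_ /eqP hy] e.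
    by apply: inj => //; rewrite -!colE hx hy.
  apply: subset_leq_card; apply/subsetP => _ /imsetP[x hx ->].
  by move: hx; rewrite !inE => /andP[].
rewrite -[leqLHS]cJ -(@card_in_imset _ _ (row_word mu) [set x | _ && _]); last first.
  move=> x y; rewrite !inE => /andP[_ /eqP hx] /andP[_ /eqP hy] e.
  by apply: (tab_inj e); rewrite -!colE hx hy.
apply: subset_leq_card; apply/subsetP => i; rewrite inE => hi.
have [|x hx1 hx2] := @tab_cell mu i c.
  rewrite -hc colE; apply: leq_trans (tab_col_lt mu x0) _.
  by apply: parts_nonincr; rewrite (leq_trans (ltnW hi)).
apply/imsetP; exists x; rewrite // inE hx1 hi /=; apply/eqP/val_inj => /=.
by rewrite -hx2 colE.
Qed.

End Tableau.

(** * Conjugacy of permutations with the same cycle lengths *)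

Section CycleType.
Variable T : finType.
Implicit Types (g h s : {perm T}) (x y : T).

Lemma perm_mod_porbit g x i : ((g ^+ i) x = (g ^+ (i %% #|porbit g x|)) x)%g.
Proof.
rewrite {1}(divn_eq i #|porbit g x|) expgD permM; congr (fun_of_perm _ _).
rewrite mulnC expgM.
have fx : (g ^+ #|porbit g x|)%g x = x by rewrite permX iter_porbit.
elim: (i %/ _)%N => [|k IH]; first by rewrite expg0 perm1.
by rewrite expgS permM fx.
Qed.

(** Exponents along a cycle matter only modulo its length, which is what makes
    the conjugating map of [cycle_type_conj] well defined. *)
Lemma perm_expg_eq g x i j : ((g ^+ i) x = (g ^+ j) x)%g -> i = j %[mod #|porbit g x|].
Proof.
rewrite perm_mod_porbit (perm_mod_porbit g x j) !permX => e.
have gt0 : (0 < #|porbit g x|)%N by rewrite lt0n card_porbit_neq0.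
apply/eqP; have := uniq_traject_porbit g x; move/uniqP => /(_ x) inj.
apply/eqP; apply: inj; rewrite ?inE ?size_traject ?ltn_mod //.
by rewrite !nth_traject ?ltn_mod.
Qed.

(** Sorting both families by size aligns them.  The matching is partial only
    because no default element of B is available. *)
Lemma match_by_size (A B : finType) (X : {set A}) (Y : {set B})
    (f : A -> nat) (f' : B -> nat) :
  perm_eq [seq f a | a in X] [seq f' b | b in Y] ->
  exists2 m : A -> option B,
    forall a, a \in X -> exists2 b, m a = Some b & (b \in Y) && (f' b == f a) &
    forall b, b \in Y -> exists2 a, a \in X & m a = Some b.
Proof.
move=> /(perm_sortP leq_total leq_trans anti_leq).
rewrite /image_mem !sort_map.
set EX := sort _ _; set EY := sort _ _ => e.
have mX a : (a \in EX) = (a \in X) by rewrite mem_sort mem_enum.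
have mY b : (b \in EY) = (b \in Y) by rewrite mem_sort mem_enum.
have sz : size EX = size EY by rewrite -(size_map f) e size_map.
exists (fun a => onth EY (index a EX)) => [a aX|b bY].
- have ia : (index a EX < size EY)%N by rewrite -sz index_mem mX.
  case E : EY ia => [|b0 EY'] // ; rewrite -E => ia.
  exists (nth b0 EY (index a EX)); first by rewrite onthE (nth_map b0).
  rewrite -mY mem_nth //= -(nth_map _ 0%N) // -e (nth_map a) ?sz //.
  by rewrite nth_index ?mX.
- have ib : (index b EY < size EX)%N by rewrite sz index_mem mY.
  case E : EX ib => [|a0 EX'] // ; rewrite -E => ib.
  exists (nth a0 EX (index b EY)); first by rewrite -mX mem_nth.
  rewrite index_uniq ?sort_uniq ?enum_uniq //.
  by rewrite onthE (nth_map b) ?index_mem ?mY // nth_index ?mY.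
Qed.

(** Match the cycles of g with cycles of h of the same length and choose a base
    point in each; the conjugating permutation sends the i-th iterate of g on a
    base point to the i-th iterate of h on the matched base point. *)
Lemma cycle_type_conj g h :
  perm_eq [seq #|pred_of_set X| | X in porbits g]
          [seq #|pred_of_set X| | X in porbits h] ->
  exists s, (h = g ^ s)%g.
Proof.
case/match_by_size => m m1 m2.
pose base (X : {set T}) x0 := odflt x0 [pick y in X].
have baseP (X : {set T}) x0 : x0 \in X -> base X x0 \in X.
  by rewrite /base; case: pickP => [y|/(_ x0) /= ->].
have base_eq (X : {set T}) x0 x1 : x0 \in X -> base X x0 = base X x1.
  by rewrite /base; case: pickP => [y|/(_ x0) /= ->].
pose tgt x := base (odflt set0 (m (porbit g x))) x.
pose src x := base (porbit g x) x.
have srcP x : porbit g (src x) = porbit g x.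
  by apply/eqP; rewrite eq_porbit_mem baseP // porbit_id.
have ex_i x : exists i, x == (g ^+ i)%g (src x).
  have /porbitP[i e] : x \in porbit g (src x) by rewrite srcP porbit_id.
  by exists i; apply/eqP.
pose f x := (h ^+ (ex_minn (ex_i x)))%g (tgt x).
have tgtP x : m (porbit g x) = Some (porbit h (tgt x)) /\
    #|porbit h (tgt x)| = #|porbit g x|.
  have [|Y mY /andP[/imsetP[y _ eY] /eqP cY]] := m1 (porbit g x); first exact: imset_f.
  rewrite /tgt mY /=.
  have yY : y \in Y by rewrite eY porbit_id.
  have -> : porbit h (base Y x) = Y.
    by rewrite -(base_eq _ _ x yY) [RHS]eY; apply/eqP; rewrite eq_porbit_mem -eY baseP.
  by [].
have srcE x i : src ((g ^+ i)%g x) = src x.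
  rewrite /src porbit_perm; apply: base_eq; exact: mem_porbit.
have tgtE x i : tgt ((g ^+ i)%g x) = tgt x.
  rewrite /tgt porbit_perm.
  have [|Y mY /andP[/imsetP[y _ eY] _]] := m1 (porbit g x); first exact: imset_f.
  have yY : y \in Y by rewrite eY porbit_id.
  by rewrite mY /= -(base_eq _ _ _ yY) (base_eq _ _ x yY).
have fE x i : f ((g ^+ i)%g (src x)) = (h ^+ i)%g (tgt x).
  rewrite /f; case: ex_minnP => j /eqP + _.
  have ss : src (src x) = src x by rewrite {1}/src srcP; symmetry; apply: base_eq; exact: porbit_id.
  have ts : tgt (src x) = tgt x.
    by have /porbitP[k e] : src x \in porbit g x; [exact: baseP (porbit_id _ _)|rewrite e tgtE].
  rewrite srcE tgtE ss ts => /perm_expg_eq e.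
  rewrite perm_mod_porbit [RHS]perm_mod_porbit.
  by move: (tgtP x) => [_ ->]; rewrite -srcP e.
have fS x : f (g x) = h (f x).
  have [i /eqP e] := ex_i x; rewrite {1}e -permM -expgSr fE expgSr permM -fE.
  by rewrite -e.
have fsurj y : exists x, f x = y.
  have [|X /imsetP[x _ ->] mX] := m2 (porbit h y); first exact: imset_f.
  have : y \in porbit h (tgt x) by case: (tgtP x); rewrite mX => -[<-]; rewrite porbit_id.
  by case/porbitP => i ->; exists ((g ^+ i)%g (src x)); rewrite fE.
have finj : injective f.
  have cardT : #|codom f| = #|T|.
    by apply: eq_card => y; rewrite inE; have [x <-] := fsurj y; rewrite codom_f.
  have /image_injP finj := introT eqP cardT.
  by move=> x y; apply: finj.
exists (perm finj); apply/permP => y.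
have [x <-] := fsurj y; rewrite -fS /conjg !permM.
have -> : ((perm finj)^-1)%g (f x) = x by rewrite -(permE finj x) permK.
by rewrite permE.
Qed.

Lemma porbit_conj g s x : porbit (g ^ s)%g (s x) = s @: porbit g x.
Proof.
apply/setP => y; apply/porbitP/imsetP => [[i ->]|[z /porbitP[i ->] ->]].
  by exists ((g ^+ i)%g x); rewrite ?mem_porbit // -conjXg /conjg !permM permK.
by exists i; rewrite -conjXg /conjg !permM permK.
Qed.

Lemma conj_cycle_type g s :
  perm_eq [seq #|pred_of_set X| | X in porbits (g ^ s)%g]
          [seq #|pred_of_set X| | X in porbits g].
Proof.
have inj : injective (fun X : {set T} => s @: X) by apply: imset_inj; apply: perm_inj.
have e : porbits (g ^ s)%g = [set s @: (X : {set T}) | X in porbits g].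
  apply/setP => Y; apply/imsetP/imsetP => [[y _ ->]|[X /imsetP[x _ ->] ->]].
    exists (porbit g (s^-1 y)%g); first exact: imset_f.
    by rewrite -porbit_conj permKV.
  by exists (s x); rewrite // porbit_conj.
have -> : [seq #|pred_of_set X| | X in porbits g] =
    [seq #|pred_of_set X| | X <- [seq s @: (X : {set T}) | X <- enum (porbits g)]].
  rewrite -map_comp; apply: eq_map => X /=; rewrite card_imset //; exact: perm_inj.
apply: perm_map; apply: uniq_perm; rewrite ?enum_uniq ?(map_inj_uniq inj) ?enum_uniq //.
move=> Y; rewrite mem_enum e.
by apply/imsetP/mapP => -[X hX ->]; exists X; rewrite // ?mem_enum // -mem_enum.
Qed.

End CycleType.

(** * Words, cycle classes and their representatives *)

Section RowCycle.
Variable n : nat.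
Implicit Types (mu lam alpha beta : intpart n) (x y : 'I_n) (g s : 'S_n)
  (w : {ffun 'I_n -> 'I_n}).

(** A right action, like the product of permutations: acting by g and then by h
    is acting by g * h. *)
Definition word_act w g : {ffun 'I_n -> 'I_n} := [ffun x => w (g^-1 x)%g].

Lemma word_act1 w : word_act w 1%g = w.
Proof. by apply/ffunP => x; rewrite ffunE invg1 perm1. Qed.

Lemma word_actM w g h : word_act w (g * h)%g = word_act (word_act w g) h.
Proof. by apply/ffunP => x; rewrite !ffunE invMg permM. Qed.

Lemma word_actK g : cancel (word_act^~ g) (word_act^~ g^-1%g).
Proof. by move=> w; rewrite -word_actM mulgV word_act1. Qed.

Lemma word_actKV g : cancel (word_act^~ g^-1%g) (word_act^~ g).
Proof. by move=> w; rewrite -word_actM mulVg word_act1. Qed.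

Lemma word_act_fixP w g : reflect (forall x, w (g x) = w x) (word_act w g == w).
Proof.
apply: (iffP eqP) => [e x|h]; first by rewrite -{1}e ffunE permK.
by apply/ffunP=> x; rewrite ffunE -h permKV.
Qed.

Lemma content_word_act w g i : content (word_act w g) i = content w i.
Proof.
rewrite /content -(card_preimset _ (@perm_inj _ g)); congr #|pred_of_set _|.
by apply/setP => x; rewrite !inE ffunE permK.
Qed.

Lemma has_weight_word_act k w g : has_weight k (word_act w g) = has_weight k w.
Proof. by apply: eq_forallb => i; rewrite content_word_act. Qed.

Lemma has_content_word_act lam w g : has_content lam (word_act w g) = has_content lam w.
Proof. exact: has_weight_word_act. Qed.

(** The next cell of the row of x, going back to the first cell after the last
    one. *)
Definition row_next mu x : 'I_n :=
  odflt x [pick y | (row_word mu y == row_word mu x) &&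
     (tab_col mu y == (tab_col mu x).+1 %% mu (row_word mu x))%N].

Lemma row_nextP mu x : row_word mu (row_next mu x) = row_word mu x /\
  tab_col mu (row_next mu x) = ((tab_col mu x).+1 %% mu (row_word mu x))%N.
Proof.
rewrite /row_next; case: pickP => [y /andP[/eqP-> /eqP->] //|/= h].
have := tab_col_lt mu x; set m : nat := mu _ => lt.
have lt' : ((tab_col mu x).+1 %% m < m)%N by rewrite ltn_mod; apply: leq_ltn_trans lt.
by have [y hr hc] := tab_cell lt'; have := h y; rewrite hr hc !eqxx.
Qed.

Lemma row_next_inj mu : injective (row_next mu).
Proof.
move=> x y e; have [rx cx] := row_nextP mu x; have [ry cy] := row_nextP mu y.
have r : row_word mu x = row_word mu y by rewrite -rx e ry.
apply: (tab_inj r); move: cx; rewrite e cy r => ce; set m : nat := mu _ in ce.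
have : tab_col mu y + 1 == tab_col mu x + 1 %[mod m] by rewrite !addn1 ce.
by rewrite eqn_modDr !modn_small ?tab_col_lt // /m -?r ?tab_col_lt // => /eqP.
Qed.

Definition row_cycle mu : 'S_n := perm (@row_next_inj mu).

Lemma row_cycleX mu x i : row_word mu ((row_cycle mu ^+ i)%g x) = row_word mu x /\
  tab_col mu ((row_cycle mu ^+ i)%g x) = ((tab_col mu x + i) %% mu (row_word mu x))%N.
Proof.
elim: i => [|i [IHr IHc]].
  by rewrite expg0 perm1 addn0 modn_small // tab_col_lt.
rewrite expgSr permM permE; have [-> ->] := row_nextP mu ((row_cycle mu ^+ i)%g x).
by rewrite IHr IHc -[(_ %% _)%N.+1]addn1 modnDml -addnA addn1.
Qed.

Lemma porbit_row_cycle mu x y :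
  (y \in porbit (row_cycle mu) x) = (row_word mu y == row_word mu x).
Proof.
apply/porbitP/eqP => [[i ->]|e]; first by have [] := row_cycleX mu x i.
(* Go forward from x to the start of the row, then on to y. *)
exists (mu (row_word mu x) - tab_col mu x + tab_col mu y)%N.
have [er ec] := row_cycleX mu x (mu (row_word mu x) - tab_col mu x + tab_col mu y)%N.
apply: (@tab_inj _ mu); first by rewrite er.
by rewrite ec addnA subnKC ?(ltnW (tab_col_lt mu x)) // modnDl modn_small // -e tab_col_lt.
Qed.

Lemma row_cycle_class mu : row_cycle mu \in cycle_class mu.
Proof.
rewrite inE filter_map /=.
pose block i := [set x | row_word mu x == i].
have cb i : #|block i| = mu i by have /has_contentP := content_row_word mu; apply.
set S := filter _ _.
have -> : [seq (mu i : nat) | i <- S] = [seq #|X| | X : {set 'I_n} <- [seq block i | i <- S]].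
  by rewrite -map_comp; apply: eq_map => i /=; rewrite cb.
apply: perm_map; apply: uniq_perm; rewrite ?enum_uniq //.
  rewrite map_inj_in_uniq => [|i j]; first by apply: filter_uniq; exact: enum_uniq.
  rewrite mem_filter /= => /andP[/tab_cell[x hx _] _] _ /setP/(_ x).
  by rewrite !inE hx eqxx => /esym/eqP.
have eb x : porbit (row_cycle mu) x = block (row_word mu x).
  by apply/setP => y; rewrite porbit_row_cycle inE.
move=> X; rewrite mem_enum; apply/imsetP/mapP => [[x _ ->]|[i]].
  exists (row_word mu x); rewrite ?eb // mem_filter mem_enum andbT /=.
  exact: leq_ltn_trans (tab_col_lt mu x).
rewrite mem_filter /= => /andP[/tab_cell[x <- _] _] ->.
by exists x; rewrite ?eb.
Qed.

Lemma cycle_class_conj mu g h : g \in cycle_class mu -> h \in cycle_class mu ->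
  exists s, (h = g ^ s)%g.
Proof.
rewrite !inE => hg hh; apply: cycle_type_conj.
by apply: (perm_trans hg); rewrite perm_sym.
Qed.

Lemma cycle_classJ mu g s : ((g ^ s)%g \in cycle_class mu) = (g \in cycle_class mu).
Proof. by rewrite !inE; apply: permPl; apply: conj_cycle_type. Qed.

Lemma cycle_classV mu g : (g^-1%g \in cycle_class mu) = (g \in cycle_class mu).
Proof. by rewrite !inE porbitsV. Qed.

Lemma repr_cycle_class mu : repr (cycle_class mu) \in cycle_class mu.
Proof. exact: mem_repr (row_cycle_class mu). Qed.

(** A word fixed by the row cycle is constant on the rows, so the first j rows
    carry at most j letters, and these letters fill at most the j largest parts
    of lam. *)
Lemma dominated_of_row_cycle_fix alpha lam w :
  has_content lam w -> (forall x, w (row_cycle alpha x) = w x) ->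
  dominated alpha lam.
Proof.
move=> hw fx; apply/dominatedP => j.
have fX i x : w ((row_cycle alpha ^+ i)%g x) = w x.
  by elim: i => [|i IH]; rewrite ?expg0 ?perm1 // expgSr permM fx.
pose F r := if [pick x | row_word alpha x == r] is Some x then w x else r.
have wF x : w x = F (row_word alpha x).
  rewrite /F; case: pickP => [y|/(_ x)]; last by rewrite eqxx.
  by rewrite -porbit_row_cycle => /porbitP[i ->]; rewrite fX.
rewrite (psum_content j (content_row_word alpha)).
pose J := [set r : 'I_n | (r < j)%N].
have cJ : (#|J| <= j)%N.
  case: (leqP j n) => hj; last first.
    by rewrite (leq_trans (max_card _)) // card_ord ltnW.
  by rewrite /J card_ord_lt.
apply: leq_trans (sum_parts_le lam (leq_trans (leq_imset_card F (mem J)) cJ)).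
have /has_contentP hc := hw.
rewrite -sum1dep_card [leqRHS](eq_bigr (content w)) => [|i _]; last by rewrite hc.
rewrite (partition_big w (mem (F @: J))) /= => [|x hx]; last first.
  by rewrite wF imset_f // inE.
apply: leq_sum => i _; rewrite /content -sum1dep_card [leqRHS](bigID (fun x => (row_word alpha x < j)%N)) /=.
apply: leq_trans (leq_addr _ _); apply/eq_leq/eq_bigl => x; exact: andbC.
Qed.

(** Conjugation reduces a permutation of type alpha to the row cycle. *)
Lemma dominated_of_fix alpha lam w g : g \in cycle_class alpha ->
  has_content lam w -> word_act w g = w -> dominated alpha lam.
Proof.
move=> hg hw fx; have [s e] := cycle_class_conj hg (row_cycle_class alpha).
apply: (@dominated_of_row_cycle_fix _ _ (word_act w s)); first by rewrite has_content_word_act.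
apply/word_act_fixP; rewrite e -!word_actM /conjg mulKVg word_actM fx //.
Qed.

Lemma row_cycle_fix alpha : word_act (row_word alpha) (row_cycle alpha) = row_word alpha.
Proof.
by apply/eqP/word_act_fixP => x; rewrite permE; case: (row_nextP alpha x).
Qed.

(** If g has both types, the two row cycles are conjugate, so each of them fixes
    a word with content the other partition; dominance is antisymmetric. *)
Lemma cycle_class_inj alpha beta g :
  g \in cycle_class alpha -> g \in cycle_class beta -> alpha = beta.
Proof.
have main a b : g \in cycle_class a -> g \in cycle_class b -> dominated a b.
  move=> ha hb; have [s e] := cycle_class_conj hb (row_cycle_class b).
  apply: (@dominated_of_fix a b (row_word b) (row_cycle b)).
  - by rewrite e cycle_classJ.
  - exact: content_row_word.
  - exact: row_cycle_fix.
by move=> ha hb; apply: dominated_anti; apply: main.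
Qed.

(** The partition is the list of cycle lengths in decreasing order, padded with
    zeros to length n. *)
Lemma cycle_class_ex g : exists alpha, g \in cycle_class alpha.
Proof.
pose s := sort geq [seq #|pred_of_set X| | X in porbits g].
(* The cycles partition the n points. *)
have sumE : sumn s = n.
  rewrite -[RHS]card_ord -cardsT (card_partition (P := porbits g)).
    rewrite /s (perm_sumn (permEl (perm_sort _ _))) sumnE big_image /=.
    by apply: eq_bigl => X.
  have -> : porbits g = equivalence_partition (fun x y => y \in porbit g x) setT.
    apply/setP => X; apply/imsetP/imsetP => -[x _ ->]; exists x => //;
    by apply/setP => y; rewrite !inE.
  apply: equivalence_partitionP => x y z _ _ _; split; first exact: porbit_id.
  by rewrite -!eq_porbit_mem => /eqP ->.
have pos k : k \in s -> (0 < k)%N.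
  rewrite mem_sort => /mapP[X]; rewrite mem_enum => /imsetP[x _ ->] ->.
  by rewrite lt0n card_porbit_neq0.
have szle : (size s <= n)%N.
  rewrite -[leqRHS]sumE; elim: (s) pos => //= a t IH h.
  have := h a (mem_head _ _); have := IH (fun k hk => h k (mem_behead (s := a :: t) hk)).
  by move=> h1 h2; rewrite -add1n leq_add.
have nthle i : (nth 0 s i < n.+1)%N.
  rewrite ltnS -[leqRHS]sumE; elim: (s) i => [|a t IH] [|i] //=; first exact: leq_addr.
  exact: leq_trans (IH i) (leq_addl _ _).
pose f : {ffun 'I_n -> 'I_n.+1} := [ffun i => Ordinal (nthle (val i))].
have mapE : [seq (f i : nat) | i : 'I_n] = s ++ nseq (n - size s) 0%N.
  apply: (@eq_from_nth _ 0%N); first by rewrite size_map -cardE card_ord size_cat size_nseq subnKC.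
  move=> i; rewrite size_map -cardE card_ord => hi.
  rewrite (nth_map (Ordinal hi)) ?size_enum_ord // ffunE /= nth_enum_ord //.
  rewrite nth_cat; case: ltnP => // hs; rewrite nth_default // nth_nseq; by case: ifP.
have fP : is_intpart f.
  apply/andP; split.
    apply/forallP => i; apply/forallP => j; apply/implyP => hij; rewrite !ffunE /=.
    case: (ltnP j (size s)) => hj; last by rewrite (nth_default _ hj).
    have geq_tr : transitive geq by move=> x y z /= h1 h2; apply: leq_trans h2 h1.
    have srt : sorted geq s by apply: sort_sorted => x y; apply: leq_total.
    by apply: (sorted_leq_nth geq_tr leqnn 0%N srt); rewrite // inE (leq_ltn_trans hij hj).
  rewrite -[X in _ == X]sumE.
  have -> : (\sum_i f i)%N = sumn [seq (f i : nat) | i : 'I_n] by rewrite sumnE big_image.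
  by rewrite mapE sumn_cat sumn_nseq mul0n addn0.
exists (IntPart fP); rewrite inE /= mapE filter_cat.
have -> : [seq k <- nseq (n - size s) 0%N | (0 < k)%N] = [::].
  by elim: (n - size s)%N.
have -> : [seq k <- s | (0 < k)%N] = s by apply/all_filterP/allP => k /pos.
by rewrite cats0 perm_sym; apply/permPl; exact: perm_sort.
Qed.

(** Two words with the same content are rearrangements of each other. *)
Lemma has_content_transitive lam w w' : has_content lam w -> has_content lam w' ->
  exists s, w' = word_act w s.
Proof.
move=> /has_contentP h /has_contentP h'.
have : perm_eq [tuple w' i | i < n] [tuple w i | i < n].
  apply/allP => i _ /=; apply/eqP.
  have cE (u : {ffun 'I_n -> 'I_n}) : count_mem i [tuple u x | x < n] = content u i.
    rewrite /content cardE /enum_mem size_filter /= count_map enumT.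
    by apply: eq_count => x; rewrite /= inE.
  by rewrite !cE h h'.
case/tuple_permP => p /val_inj e; exists p^-1%g.
apply/ffunP => x; rewrite ffunE invgK.
by have := congr1 (fun t : n.-tuple 'I_n => tnth t x) e; rewrite !tnth_mktuple.
Qed.
End RowCycle.

(** * Counting Young subgroups by fixed words *)

Section YoungCosets.
Variable n : nat.
Implicit Types (mu lam alpha beta : intpart n) (x y : 'I_n) (g h s : 'S_n)
  (w : {ffun 'I_n -> 'I_n}).

Definition word_stab w : {set 'S_n} := [set g | word_act w g == w].

Lemma word_stab_group_set w : group_set (word_stab w).
Proof.
apply/group_setP; split=> [|g h]; rewrite !inE ?word_act1 //.
by move=> /eqP hg /eqP hh; rewrite word_actM hg hh.
Qed.
Canonical word_stab_group w := Group (word_stab_group_set w).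

Lemma word_stab_act w s : word_stab (word_act w s) = (word_stab w :^ s)%g.
Proof.
apply/setP => g; rewrite mem_conjg !inE /conjg invgK -[in RHS](can_eq (word_actK s)).
by rewrite -!word_actM -!mulgA mulVg mulg1.
Qed.

Definition fibers w : {ffun 'I_n -> {set 'I_n}} := [ffun i => [set x | w x == i]].

Lemma ordered_set_partitionP lam P :
  reflect (exists2 w, has_content lam w & P = fibers w)
          (is_ordered_set_partition lam P).
Proof.
apply: (iffP and3P) => [[/forallP dis /eqP cov /forallP card]|[w /has_contentP hw ->]].
  have ex x : exists i, x \in P i.
    have : x \in \bigcup_i P i by rewrite cov inE.
    by case/bigcupP => i _; exists i.
  pose w := [ffun x => xchoose (ex x)].
  have wP : P = fibers w.
    apply/ffunP => i; apply/setP => x; rewrite !ffunE inE ffunE.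
    have hx := xchooseP (ex x).
    apply/idP/eqP => [hi|<- //]; apply/eqP; apply: contraT => ne.
    have /forallP/(_ i) := dis (xchoose (ex x)); rewrite ne /= => /disjointFr /(_ hx).
    by rewrite hi.
  exists w => //; apply/has_contentP => i; have /eqP := card i.
  by rewrite wP ffunE.
split.
- apply/forallP=> i; apply/forallP=> j; apply/implyP => ne.
  apply/pred0P => x /=; rewrite !ffunE !inE; apply/negbTE; apply: contra ne.
  by case/andP=> /eqP <- /eqP <-.
- apply/eqP/setP => x; rewrite inE; apply/bigcupP; exists (w x) => //.
  by rewrite ffunE inE.
- by apply/forallP => i; rewrite ffunE -hw.
Qed.

Lemma young_subgroup_fibers w : young_subgroup (fibers w) = word_stab w.
Proof.
apply/setP => g; rewrite !inE; apply/forallP/word_act_fixP => [h x|h i].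
  have /eqP := h (w x); rewrite ffunE => /setP/(_ (g x)).
  by rewrite imset_f ?inE // => /esym/eqP.
rewrite eqEcard card_imset ?leqnn ?andbT; last exact: perm_inj.
by apply/subsetP => _ /imsetP[x + ->]; rewrite !ffunE !inE h.
Qed.

(** The permutation character on the words of content lam. *)
Definition nfixed_words lam g : nat := #|[set w | has_content lam w && (word_act w g == w)]|.

Lemma nfixed_wordsJ lam g s : nfixed_words lam (g ^ s)%g = nfixed_words lam g.
Proof.
rewrite /nfixed_words -(card_preimset _ (can_inj (word_actK s))); congr #|pred_of_set _|.
apply/setP => w; rewrite !inE has_content_word_act /conjg -!word_actM mulKVg.
by rewrite word_actM (can_eq (word_actK s)).
Qed.

Lemma nfixed_wordsV lam g : nfixed_words lam g^-1%g = nfixed_words lam g.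
Proof.
rewrite /nfixed_words; congr #|pred_of_set _|; apply/setP => w; rewrite !inE.
by rewrite -(can_eq (word_actK g)) -!word_actM mulVg word_act1 eq_sym.
Qed.

(** The number of ways to number the blocks of a Young subgroup of shape lam; it
    is computed at the row word but depends only on lam, see [nwords_per_youngE]. *)
Definition nwords_per_young lam : nat :=
  #|[set w | has_content lam w && (word_stab w == word_stab (row_word lam))]|.

Lemma nwords_per_young_gt0 lam : (0 < nwords_per_young lam)%N.
Proof.
by rewrite card_gt0; apply/set0Pn; exists (row_word lam); rewrite inE content_row_word eqxx.
Qed.

Lemma nwords_per_youngE lam w0 : has_content lam w0 ->
  #|[set w | has_content lam w && (word_stab w == word_stab w0)]| = nwords_per_young lam.
Proof.
move=> h0; have [s ->] := has_content_transitive (content_row_word lam) h0.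
rewrite -(card_preimset _ (can_inj (word_actK s))); congr #|pred_of_set _|.
apply/setP => w; rewrite !inE has_content_word_act !word_stab_act; congr (_ && _).
by rewrite (can_eq (conjsgK s)).
Qed.

Lemma young_cosets_pair lam g h :
  [set Z in young_cosets lam | (g \in Z) && (h \in Z)] =
  [set (g *: word_stab w)%g | w in [set w | has_content lam w && (word_act w (g^-1 * h)%g == w)]].
Proof.
apply/setP => Z; rewrite inE; apply/idP/imsetP.
  case/and3P => /imset2P[k P _ /ordered_set_partitionP[w hw ->] ->].
  rewrite young_subgroup_fibers => hg.
  have <- := lcoset_eqP hg; rewrite mem_lcoset => hh; exists w => //.
  by move: hh; rewrite !inE hw.
case=> w; rewrite !inE => /andP[hw fx] ->; rewrite lcoset_refl mem_lcoset inE fx andbT.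
apply/andP; split => //; apply/imset2P; exists g (fibers w) => //.
  by apply/ordered_set_partitionP; exists w.
by rewrite young_subgroup_fibers.
Qed.

(** The map that sends a word fixed by g^-1 h to the coset of its stabilizer
    through g hits every coset containing g and h, with fibers of constant
    size. *)
Lemma card_young_cosets_pair lam g h :
  (nwords_per_young lam * #|[set Z in young_cosets lam | (g \in Z) && (h \in Z)]|)%N =
  nfixed_words lam (g^-1 * h)%g.
Proof.
rewrite young_cosets_pair /nfixed_words; set W := [set w | _].
rewrite mulnC -sum_nat_const -[RHS]sum1_card.
rewrite [RHS](partition_big_imset (fun w => (g *: word_stab w)%g)) /=.
apply: eq_bigr => _ /imsetP[w0 + ->]; rewrite inE => /andP[h0 f0].
rewrite -(nwords_per_youngE h0) -sum1dep_card; apply: eq_bigl => w.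
rewrite inE (can_eq (lcosetK g)); case: eqP => [e|]; rewrite ?andbF // !andbT.
have : (g^-1 * h)%g \in word_stab w by rewrite e inE.
by rewrite inE => ->; rewrite andbT.
Qed.

Lemma AclassE (F : realType) alpha i j :
  Aclass F alpha i j = (enum_val i * (enum_val j)^-1 \in cycle_class alpha)%g%:R.
Proof.
set g := (_ * _)%g.
rewrite summxE (eq_bigr (fun h => (g == h)%:R)) => [|h _]; last by rewrite mxE.
  case: (boolP (g \in _)) => hg.
    by rewrite (bigD1 g hg) /= eqxx big1 ?addr0 // => h /andP[_]; rewrite eq_sym => /negbTE ->.
  by rewrite big1 // => h hh; case: eqP => // e; rewrite e hh in hg.
Qed.

Lemma class_sum_mxE (F : realType) (f : 'S_n -> F) i j :
  (forall g s, f (g ^ s)%g = f g) ->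
  (\sum_alpha f (repr (cycle_class alpha)) *: Aclass F alpha) i j =
  f (enum_val i * (enum_val j)^-1)%g.
Proof.
move=> fJ; set g := (_ * _)%g; have [a ha] := cycle_class_ex g.
rewrite summxE (bigD1 a) //= mxE AclassE ha mulr1 big1 ?addr0 => [|b ne]; last first.
  rewrite mxE AclassE; case: (boolP (g \in _)) => [hb|]; last by rewrite mulr0.
  by rewrite (cycle_class_inj hb ha) eqxx in ne.
by have [s ->] := cycle_class_conj (repr_cycle_class a) ha; rewrite fJ.
Qed.

Lemma CmxE (F : realType) lam i j :
  Cmx F lam i j =
    (nwords_per_young lam)%:R^-1 * (nfixed_words lam ((enum_val i)^-1 * enum_val j)%g)%:R.
Proof.
rewrite -card_young_cosets_pair natrM mulKf ?Num.Theory.pnatr_eq0 -?lt0n ?nwords_per_young_gt0 //.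
rewrite !mxE -sum1dep_card natr_sum big_mkcondr /= [RHS]big_enum_val.
apply: eq_bigr => k _; rewrite !mxE -natrM mulnb; by case: ifP.
Qed.

Lemma Cmx_class_sum (F : realType) lam :
  Cmx F lam = \sum_alpha
    ((nwords_per_young lam)%:R^-1 * (nfixed_words lam (repr (cycle_class alpha)))%:R) *: Aclass F alpha.
Proof.
apply/matrixP => i j.
rewrite (@class_sum_mxE F (fun g => (nwords_per_young lam)%:R^-1 * (nfixed_words lam g)%:R)); last first.
  by move=> g s; rewrite nfixed_wordsJ.
rewrite CmxE; congr (_ * _%:R); rewrite -[RHS]nfixed_wordsV -(nfixed_wordsJ _ _ (enum_val i)^-1).
by rewrite /conjg invMg !invgK !mulgA mulgV mul1g.
Qed.
End YoungCosets.

(** * Pairing the character of a cyclic right ideal with a representation *)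

(** The rank factorization P = c r of an idempotent satisfies r c = 1. *)
Lemma mxtrace_idempotent (F : fieldType) m (P : 'M[F]_m) :
  P *m P = P -> \tr P = (\rank P)%:R.
Proof.
move=> idP; rewrite -{1}(mulmx_base P) mxtrace_mulC.
suff -> : row_base P *m col_base P = 1%:M by rewrite mxtrace1.
set c := col_base P; set r := row_base P; have e : c *m r = P := mulmx_base P.
apply: (row_free_inj (row_base_free P)); apply: (@row_full_inj _ _ _ _ (col_base P)).
  exact: col_base_full.
by rewrite mul1mx -(mulmxA r) e (mulmxA c) e.
Qed.

Section GroupAlgebra.
Variables (F : numFieldType) (gT : finGroupType) (G : {group gT}).
Local Notation aG := (regular_repr F G).
Local Notation idx := (gring_index G).

Lemma gring_mx_sum m (rG : mx_representation F G m) (a : 'rV_#|G|) :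
  gring_mx rG a = \sum_(g in G) a 0 (idx g) *: rG g.
Proof.
rewrite /gring_mx /= mulmx_sum_row linear_sum [RHS]big_enum_val /=.
by apply: eq_bigr => i _; rewrite linearZ /= rowK mxvecK gring_valK.
Qed.

(** Right multiplication by g shifts the coefficients of a group algebra
    element. *)
Lemma regular_coef (a : 'rV[F]_#|G|) g h : g \in G -> h \in G ->
  (a *m aG g) 0 (idx h) = a 0 (idx (h * g^-1)%g).
Proof.
move=> Gg Gh; rewrite mxE (bigD1 (idx (h * g^-1)%g)) //= big1 ?addr0 => [|i ne].
  by rewrite !mxE gring_indexK ?groupM ?groupV // mulgKV !eqxx mulr1.
rewrite !mxE eqxx /=; case: eqP => [e|]; last by rewrite mulr0.
case/eqP: ne; have /(congr1 enum_val) := e; rewrite !gring_indexK ?groupM ?enum_valP // => ->.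
by rewrite mulgK gring_valK.
Qed.

(** The trace on a submodule can be computed on the whole space after any linear
    projection onto it, which need not commute with the group. *)
Lemma mxtrace_submod m (rG : mx_representation F G m) (U P : 'M[F]_m)
    (Umod : mxmodule rG U) g : g \in G ->
  (P <= U)%MS -> U *m P = U -> \tr (submod_repr Umod g) = \tr (rG g *m P).
Proof.
move=> Gg PU UP; rewrite /= /submod_mx in_submodE.
set X := _ *m rG g.
have : (X <= U)%MS by rewrite mxmodule_trans ?val_submodP.
case/submxP => Y eX.
have {eX} eX : X = X *m P by rewrite eX -mulmxA UP.
have -> : X *m in_submod U 1%:M = val_submod 1%:M *m (rG g *m P *m in_submod U 1%:M).
  by rewrite {1}eX /X !mulmxA.
by rewrite mxtrace_mulC -(mulmxA (rG g)) -in_submodE -mulmxA -val_submodE in_submodK.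
Qed.

(** Write 1 = e + f along a Maschke decomposition into right ideals U and W.  For
    u in U, the element u - e u = f u is both in U and in W, hence zero. *)
Lemma right_ideal_unit (U : 'M[F]_#|G|) : mxmodule aG U ->
  exists2 e : 'rV_#|G|, (e <= U)%MS &
    forall u : 'rV_#|G|, (u <= U)%MS -> e *m gring_mx aG u = u.
Proof.
move=> Umod.
have red : mx_completely_reducible aG 1%:M.
  apply: mx_Maschke_pchar; rewrite /pgroup.pgroup pcharf'_nat.
  by rewrite Num.Theory.pnatr_eq0 -lt0n cardG_gt0.
have [W Wmod UW dUW] := red U Umod (submx1 U).
(* The unit of the group algebra. *)
pose one : 'rV[F]_#|G| := delta_mx 0 (idx 1%g).
have : (one <= U + W)%MS by rewrite UW submx1.
case/sub_addsmxP => -[x y] /= e1.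
exists (x *m U); first exact: submxMl.
move=> u uU; have one_u : one *m gring_mx aG u = u by rewrite -rowE -[RHS](gring_mxK u).
have eq : u - x *m U *m gring_mx aG u = y *m W *m gring_mx aG u.
  by rewrite -{1}one_u e1 mulmxDl addrC addKr.
have ideal (V : 'M[F]_#|G|) (v : 'rV_#|G|) : mxmodule aG V -> (v <= V)%MS -> (v *m gring_mx aG u <= V)%MS.
  by move=> Vmod vV; apply: mxmodule_envelop Vmod _ vV; rewrite vec_mxK submxMl.
apply/eqP; rewrite eq_sym -subr_eq0 -submx0 -(mxdirect_addsP dUW) sub_capmx.
rewrite {2}eq ideal ?submxMl // andbT addmx_sub // eqmx_opp ideal ?submxMl //.
Qed.

(** Left multiplication by e is a projection onto U, and it only remains to read
    the diagonal of a product of regular matrices. *)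
Lemma mxtrace_right_ideal (U : 'M[F]_#|G|) (Umod : mxmodule aG U) (e : 'rV_#|G|) g :
  g \in G -> (e <= U)%MS ->
  (forall u : 'rV_#|G|, (u <= U)%MS -> e *m gring_mx aG u = u) ->
  \tr (submod_repr Umod g) = \sum_(h in G) e 0 (idx (g^-1 ^ h^-1)%g).
Proof.
move=> Gg eU eid.
pose L : 'M[F]_#|G| := \matrix_i (e *m aG (enum_val i)).
have LE (u : 'rV_#|G|) : u *m L = e *m gring_mx aG u.
  rewrite mulmx_sum_row gring_mx_sum mulmx_sumr [RHS]big_enum_val /=.
  by apply: eq_bigr => i _; rewrite rowK gring_valK scalemxAr.
rewrite (@mxtrace_submod _ _ _ L) //; last 2 first.
- by apply/row_subP => i; rewrite rowK mxmodule_trans ?enum_valP.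
- by apply/row_matrixP => i; rewrite row_mul LE eid // row_sub.
rewrite /mxtrace [RHS]big_enum_val /=; apply: eq_bigr => i _.
transitivity (row i (aG g *m L) 0 i); first by rewrite [RHS]mxE.
rewrite row_mul rowK -rowE rowK gring_indexK ?groupM ?enum_valP //.
rewrite -[X in (_ *m _) 0 X](gring_valK i) regular_coef ?groupM ?enum_valP //.
by rewrite invMg /conjg invgK !mulgA.
Qed.

(** Summing over the group turns the conjugates of e into copies of e, because M
    commutes with the representation. *)
Lemma sum_mxtrace_right_ideal (U : 'M[F]_#|G|) (Umod : mxmodule aG U) (e : 'rV_#|G|)
    m (rG : mx_representation F G m) (M : 'M[F]_m) :
  (e <= U)%MS -> (forall u : 'rV_#|G|, (u <= U)%MS -> e *m gring_mx aG u = u) ->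
  (forall g, g \in G -> M *m rG g = rG g *m M) ->
  \sum_(g in G) \tr (submod_repr Umod g^-1%g) * \tr (rG g *m M) =
  #|G|%:R * \tr (gring_mx rG e *m M).
Proof.
move=> eU eid cM.
under eq_bigr => g Gg do rewrite (mxtrace_right_ideal Umod _ eU) ?groupV // invgK mulr_suml.
rewrite exchange_big /=.
transitivity (\sum_(h in G) \tr (gring_mx rG e *m M)); last first.
  by rewrite sumr_const mulr_natl.
apply: eq_bigr => h Gh; rewrite gring_mx_sum mulmx_suml raddf_sum /=.
rewrite (reindex_inj (conjg_inj h)) /=.
apply: eq_big => [g|g]; first by rewrite groupJr.
rewrite groupJr // => Gg; rewrite conjgK -scalemxAl mxtraceZ; congr (_ * _).
rewrite /conjg !repr_mxM ?groupM ?groupV // -!mulmxA mxtrace_mulC -!mulmxA.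
by rewrite cM ?groupV // (mulmxA (rG h)) -repr_mxM ?groupV // mulgV repr_mx1 mul1mx.
Qed.

(** The element e of [right_ideal_unit] acts on the image of M as an idempotent,
    so the pairing is the order of G times a rank.  Since e is a multiple of c
    and e c = c, the elements e and c vanish on the same images. *)
Lemma cyclic_character_pairing_eq0 (c : 'rV[F]_#|G|)
    m (rG : mx_representation F G m) (M : 'M[F]_m) :
  M *m M = M -> (forall g, g \in G -> M *m rG g = rG g *m M) ->
  (\sum_(g in G) \tr (submod_repr (cyclic_mx_module aG c) g^-1%g) * \tr (rG g *m M) == 0)
   = (gring_mx rG c *m M == 0).
Proof.
move=> idM cM; have [e eU eid] := right_ideal_unit (cyclic_mx_module aG c).
have cMa a : M *m gring_mx rG a = gring_mx rG a *m M.
  rewrite gring_mx_sum mulmx_sumr mulmx_suml; apply: eq_bigr => g Gg.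
  by rewrite -scalemxAr cM // scalemxAl.
rewrite (sum_mxtrace_right_ideal _ eU eid cM).
rewrite mxtrace_idempotent; last first.
  by rewrite -{1}cMa mulmxA -(mulmxA M) -gring_mxA (eid e eU) -mulmxA -cMa mulmxA idM cMa.
rewrite mulf_eq0 !Num.Theory.pnatr_eq0 eqn0Ngt cardG_gt0 /= mxrank_eq0.
apply/eqP/eqP => h0.
  rewrite -(eid c (cyclic_mx_id _ _)) gring_mxA -mulmxA -cMa mulmxA h0 mul0mx //.
have [A EA ->] := cyclic_mxP eU.
by rewrite -(gring_rowK EA) gring_mxA -mulmxA -cMa mulmxA h0 mul0mx.
Qed.

End GroupAlgebra.

(** * The word representation and its letter-changing operators *)

Section KernelMatrix.
Variables (R : pzSemiRingType) (T : finType).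
Implicit Types K L : T -> T -> R.

(** Matrices indexed by a finite type instead of an initial segment. *)
Definition kernel_mx K : 'M[R]_#|T| := \matrix_(i, j) K (enum_val i) (enum_val j).

Lemma sum_enum_rank (f : T -> R) : \sum_t f t = \sum_(i < #|T|) f (enum_val i).
Proof.
by rewrite (reindex (@enum_val T predT)) //=; apply/onW_bij/enum_val_bij.
Qed.

Lemma kernel_mxM K L : kernel_mx K *m kernel_mx L = kernel_mx (fun s t => \sum_u K s u * L u t).
Proof.
apply/matrixP => i j; rewrite !mxE sum_enum_rank.
by apply: eq_bigr => k _; rewrite !mxE.
Qed.

Lemma eq_kernel_mx K L : (forall s t, K s t = L s t) -> kernel_mx K = kernel_mx L.
Proof. by move=> e; apply/matrixP => i j; rewrite !mxE. Qed.

Lemma kernel_mxE K s t : kernel_mx K (enum_rank s) (enum_rank t) = K s t.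
Proof. by rewrite mxE !enum_rankK. Qed.

Lemma mxtrace_kernel K : \tr (kernel_mx K) = \sum_t K t t.
Proof.
rewrite /mxtrace sum_enum_rank.
by apply: eq_bigr => k _; rewrite !mxE.
Qed.
End KernelMatrix.

Section SumOfSquares.
Variable R : realFieldType.
Import Num.Theory.

Lemma mxtrace_mul_tr_ge0 m p (A : 'M[R]_(m, p)) : 0 <= \tr (A *m A^T).
Proof.
apply: sumr_ge0 => i _; rewrite mxE; apply: sumr_ge0 => j _.
by rewrite mxE -expr2 sqr_ge0.
Qed.

Lemma mxtrace_mul_tr_eq0 m p (A : 'M[R]_(m, p)) : \tr (A *m A^T) = 0 -> A = 0.
Proof.
move=> h; apply/matrixP => i j; rewrite mxE.
have sq k l : 0 <= A k l * A^T l k by rewrite mxE -expr2 sqr_ge0.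
have ge k : 0 <= (A *m A^T) k k by rewrite mxE; apply: sumr_ge0.
have := psumr_eq0P (fun k _ => ge k) h (i := i) isT; rewrite mxE => h'.
have := psumr_eq0P (fun l _ => sq i l) h' (i := j) isT.
by rewrite mxE -expr2 => h2; apply/eqP; rewrite -sqrf_eq0 h2.
Qed.
End SumOfSquares.

Section WordModule.
Variables (R : realFieldType) (n : nat).
Local Notation word := {ffun 'I_n -> 'I_n}.
Local Notation G := [set: 'S_n]%G.
Implicit Types (w u : word) (x y i j : 'I_n) (k : 'I_n -> nat).

Definition word_mx (g : 'S_n) : 'M[R]_#|{: word}| :=
  kernel_mx (fun w u => (word_act w g == u)%:R).

Lemma word_mx_kernel (K : word -> word -> R) g :
  word_mx g *m kernel_mx K = kernel_mx (fun w u => K (word_act w g) u).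
Proof.
rewrite kernel_mxM; apply: eq_kernel_mx => w u.
rewrite (bigD1 (word_act w g)) //= eqxx mul1r big1 ?addr0 // => v ne.
by rewrite eq_sym (negbTE ne) mul0r.
Qed.

Lemma kernel_word_mx (K : word -> word -> R) g :
  kernel_mx K *m word_mx g = kernel_mx (fun w u => K w (word_act u g^-1)).
Proof.
rewrite kernel_mxM; apply: eq_kernel_mx => w u.
rewrite (bigD1 (word_act u g^-1)) //= word_actKV eqxx mulr1 big1 ?addr0 // => v ne.
by rewrite -(can2_eq (word_actK g) (word_actKV g)) in ne; rewrite (negbTE ne) mulr0.
Qed.

Lemma word_mx_repr : mx_repr G word_mx.
Proof.
split=> [|g h _ _].
  apply/matrixP => i j; rewrite !mxE word_act1; congr (_%:R); congr (nat_of_bool _).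
  by rewrite (inj_eq enum_val_inj).
by rewrite word_mx_kernel; apply: eq_kernel_mx => w u; rewrite word_actM.
Qed.
Canonical word_repr := MxRepresentation word_mx_repr.

Definition weight_mx k : 'M[R]_#|{: word}| :=
  kernel_mx (fun w u => ((w == u) && has_weight k w)%:R).

Lemma weight_mx_kernel (K : word -> word -> R) k :
  weight_mx k *m kernel_mx K = kernel_mx (fun w u => (has_weight k w)%:R * K w u).
Proof.
rewrite kernel_mxM; apply: eq_kernel_mx => w u; rewrite (bigD1 w) //= eqxx big1 ?addr0 // => v ne.
by rewrite eq_sym (negbTE ne) mul0r.
Qed.

Lemma kernel_weight_mx (K : word -> word -> R) k :
  kernel_mx K *m weight_mx k = kernel_mx (fun w u => K w u * (has_weight k u)%:R).
Proof.
rewrite kernel_mxM; apply: eq_kernel_mx => w u; rewrite (bigD1 u) //= eqxx big1 ?addr0 // => v ne.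
by rewrite (negbTE ne) mulr0.
Qed.

Lemma weight_mx_idem k : weight_mx k *m weight_mx k = weight_mx k.
Proof.
rewrite {2}/weight_mx weight_mx_kernel; apply: eq_kernel_mx => w u.
by rewrite -natrM mulnb; case: (has_weight k w); rewrite ?andbF // andbT.
Qed.

Lemma weight_mxC k g : weight_mx k *m word_mx g = word_mx g *m weight_mx k.
Proof.
rewrite weight_mx_kernel kernel_weight_mx; apply: eq_kernel_mx => w u.
by case: eqP => [<-|]; rewrite ?mulr0 ?mul0r // has_weight_word_act mulrC.
Qed.

Definition set_letter w x j : word := [ffun y => if y == x then j else w y].

(** The matrix unit (i, j) acting on the tensor factor at position x, when words
    are seen as the standard basis of a tensor power. *)
Definition letter_mx x i j : 'M[R]_#|{: word}| :=
  kernel_mx (fun w u => ((w x == i) && (u == set_letter w x j))%:R).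

Lemma letter_mxM x y i j i' j' : letter_mx x i j *m letter_mx y i' j' =
  kernel_mx (fun w u => [&& w x == i, set_letter w x j y == i'
                   & u == set_letter (set_letter w x j) y j']%:R).
Proof.
rewrite kernel_mxM; apply: eq_kernel_mx => w u; rewrite (bigD1 (set_letter w x j)) //= eqxx.
rewrite big1 ?addr0 => [|v /negbTE ->]; last by rewrite andbF mul0r.
by rewrite andbT -natrM mulnb.
Qed.

Lemma letter_mx_comm x y i j i' j' : x != y ->
  letter_mx x i j *m letter_mx y i' j' = letter_mx y i' j' *m letter_mx x i j.
Proof.
move=> ne; rewrite !letter_mxM; apply: eq_kernel_mx => w u; rewrite !ffunE.
rewrite [y == x]eq_sym !(negbTE ne) andbCA; congr ((_ && (_ && (u == _)))%:R).
apply/ffunP => z; rewrite !ffunE; case: (eqVneq z x) => [->|//].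
by rewrite (negbTE ne).
Qed.

Lemma letter_mx_mul x i j : letter_mx x i j *m letter_mx x j i = letter_mx x i i.
Proof.
rewrite letter_mxM; apply: eq_kernel_mx => w u; rewrite !ffunE !eqxx /=.
congr ((_ && (u == _))%:R).
by apply/ffunP => z; rewrite !ffunE; case: eqP.
Qed.

Lemma letter_mx_tr x i j : (letter_mx x i j)^T = letter_mx x j i.
Proof.
apply/matrixP => a b; rewrite !mxE; congr ((nat_of_bool _)%:R).
move: (enum_val a) (enum_val b) => w u.
apply/andP/andP => -[/eqP <- /eqP ->]; rewrite !ffunE eqxx; split=> //;
by apply/eqP/ffunP => z; rewrite !ffunE; case: eqP => // ->.
Qed.

(** The action of the matrix unit (i, j) of gl_n on the tensor power: the sum of
    all ways to change one letter i into j. *)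
Definition move_mx i j := \sum_x letter_mx x i j.

Lemma move_mx_tr i j : (move_mx i j)^T = move_mx j i.
Proof. by rewrite linear_sum; apply: eq_bigr => x _; rewrite /= letter_mx_tr. Qed.

(** The relation [e, f] = h of sl_2: operators at different positions commute, so
    only the terms with both letter changes at the same position survive. *)
Lemma move_mx_bracket i j :
  move_mx i j *m move_mx j i - move_mx j i *m move_mx i j =
  move_mx i i - move_mx j j.
Proof.
have prod a b : move_mx a b *m move_mx b a =
    \sum_x \sum_y letter_mx x a b *m letter_mx y b a.
  by rewrite mulmx_suml; apply: eq_bigr => x _; rewrite mulmx_sumr.
rewrite !prod [X in _ - X]exchange_big -!sumrB /=; apply: eq_bigr => x _.
rewrite -sumrB (bigD1 x) //= big1 ?addr0 => [|y ne]; first by rewrite !letter_mx_mul.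
by rewrite letter_mx_comm ?subrr // eq_sym.
Qed.

(** The diagonal operator multiplies a word by its number of letters i. *)
Lemma weight_move_diag k i : weight_mx k *m move_mx i i = (k i)%:R *: weight_mx k.
Proof.
have -> : move_mx i i = kernel_mx (fun w u => ((w == u) * content w i)%:R).
  apply/matrixP => a b; rewrite summxE mxE.
  rewrite /content -sum1dep_card big_distrr natr_sum [RHS]big_mkcond /=.
  apply: eq_bigr => x _; rewrite mxE; move: (enum_val a) (enum_val b) => w u.
  case: (eqVneq (w x) i) => [e|]; last by [].
  rewrite muln1 eq_sym; congr ((nat_of_bool (_ == _))%:R).
  by apply/ffunP => y; rewrite ffunE; case: eqP => // ->.
apply/matrixP => a b; rewrite weight_mx_kernel !mxE.
rewrite -!natrM; congr (_%:R).
case: (boolP (has_weight k _)) => [/forallP/(_ i)/eqP ->|]; last by rewrite andbF muln0.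
by rewrite andbT mul1n mulnC.
Qed.

Lemma move_mxC i j g : move_mx i j *m word_mx g = word_mx g *m move_mx i j.
Proof.
rewrite mulmx_suml mulmx_sumr [RHS](reindex_inj (@perm_inj _ g)) /=.
apply: eq_bigr => x _; rewrite kernel_word_mx word_mx_kernel; apply: eq_kernel_mx => w u.
rewrite ffunE permK; congr ((_ && _)%:R).
rewrite (can2_eq (word_actKV g) (word_actK g)); congr (u == _).
by apply/ffunP => y; rewrite !ffunE (canF_eq (permKV g)).
Qed.

Definition move_weight k i j : 'I_n -> nat :=
  fun l => if l == i then (k i).-1 else if l == j then (k j).+1 else k l.

(** Changing a letter i into j maps content k to content [move_weight k i j]. *)
Lemma weight_move k i j : i != j ->
  weight_mx k *m move_mx i j = weight_mx k *m move_mx i j *m weight_mx (move_weight k i j).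
Proof.
move=> ne; rewrite mulmx_sumr mulmx_suml; apply: eq_bigr => x _.
rewrite weight_mx_kernel kernel_weight_mx; apply: eq_kernel_mx => w u.
case: (boolP (has_weight k w)) => [/forallP h|]; last by rewrite !mul0r.
case: eqP => [e|]; last by rewrite mulr0 mul0r.
case: eqP => [->|]; last by rewrite mulr0 mul0r.
suff -> : has_weight (move_weight k i j) (set_letter w x j) by rewrite !mulr1.
have cardE l : (content (set_letter w x j) l + (l == i) = content w l + (l == j))%N.
  rewrite /content (cardsD1 x [set y | w y == l]) (cardsD1 x [set y | _ == l]).
  rewrite !inE ffunE eqxx e.
  have -> : [set y | set_letter w x j y == l] :\ x = [set y | w y == l] :\ x.
    by apply/setP => y; rewrite !inE ffunE; case: eqP.
  by rewrite (eq_sym l) (eq_sym l) addnAC [RHS]addnAC; congr (_ + _)%N; exact: addnC.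
apply/forallP => l; have := cardE l; rewrite (eqP (h l)) /move_weight.
case: (eqVneq l i) => [->|]; first by rewrite (negbTE ne) addn0 addn1 => <-.
by move=> _; case: eqP => [->|_]; rewrite !addn0 ?addn1 => ->.
Qed.

(** For v of weight k with v U = 0, the bracket gives
    0 = |v U|^2 = |v U^T|^2 + (k_i - k_j) |v|^2, so v = 0.  This is done for all
    rows of A at once, with the trace of A A^T as sum of squares. *)
Lemma move_mx_inj k i j (A : 'M[R]_#|{: word}|) : (k j < k i)%N ->
  A *m weight_mx k = A -> A *m move_mx i j = 0 -> A = 0.
Proof.
move=> lt wA; have AH : A *m (move_mx i i - move_mx j j) = ((k i)%:R - (k j)%:R) *: A.
  by rewrite -{1}wA -mulmxA mulmxBr !weight_move_diag -scalerBl -scalemxAr wA.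
move=> AU; apply: mxtrace_mul_tr_eq0; apply/eqP; rewrite Order.POrderTheory.eq_le.
rewrite mxtrace_mul_tr_ge0 andbT.
have gt0 : 0 < (k i)%:R - (k j)%:R :> R by rewrite Num.Theory.subr_gt0 Num.Theory.ltr_nat.
rewrite -(Num.Theory.pmulr_rle0 _ gt0) -mxtraceZ scalemxAl -AH -move_mx_bracket.
rewrite mulmxBr mulmxA AU mul0mx sub0r mulNmx linearN /= Num.Theory.oppr_le0.
have e : move_mx i j *m A^T = (A *m move_mx j i)^T by rewrite trmx_mul move_mx_tr.
rewrite (mulmxA A) -(mulmxA (A *m _)) e.
exact: mxtrace_mul_tr_ge0.
Qed.

End WordModule.

(** * Young symmetrizers on words and on Specht modules *)

Section Dominance.
Variable n : nat.
Implicit Types (lam : intpart n) (k : 'I_n -> nat) (i j l : 'I_n).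

Definition wsum k m := (\sum_(l < n | (l < m)%N) k l)%N.

(** Moving a unit from i to j lowers exactly the partial sums that separate i
    from j; both sides carry an indicator to avoid subtraction. *)
Lemma wsum_move k i j m : i != j -> (0 < k i)%N ->
  (wsum (move_weight k i j) m + (i < m) = wsum k m + (j < m))%N.
Proof.
move=> ne ki.
have ind l0 : (\sum_(l < n | (l < m)%N) (l == l0) = (l0 < m))%N.
  case: (ltnP l0 m) => h.
    by rewrite (bigD1 l0) //= eqxx big1 ?addn0 // => l /andP[_ /negbTE ->].
  by rewrite big1 // => l hl; case: eqP => // e; rewrite e ltnNge h in hl.
rewrite -!ind /wsum -!big_split /=; apply: eq_bigr => l _; rewrite /move_weight.
case: (eqVneq l i) => [->|_]; first by rewrite (negbTE ne) addn0 addn1 prednK.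
by case: eqP => [->|_]; rewrite ?addn0 ?addn1.
Qed.

(** A weight that dominates lam is brought down to lam by moving units from
    larger to smaller entries.  Take the first index i where k differs from lam
    and the first index j where k is below lam: then i < j and
    k_i > lam_i >= lam_j > k_j, and after the move the weight still dominates lam.
    The intermediate weights may fail to be non-increasing, so the induction runs
    over all compositions. *)
Lemma dominance_ind lam (Q : ('I_n -> nat) -> Prop) :
  (forall k k', k =1 k' -> Q k -> Q k') ->
  (forall k i j, i != j -> (k j < k i)%N -> Q k -> Q (move_weight k i j)) ->
  forall k, (\sum_l k l = n)%N -> (forall m, psum lam m <= wsum k m)%N ->
  Q k -> Q (fun l => lam l).
Proof.
move=> Qext Qmove k; have [N] := ubnP (\sum_(m < n.+1) wsum k m)%N.
elim: N k => // N IH k; rewrite ltnS => hN sk dom Qk.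
case: (pickP (fun l => (lam l : nat) != k l)) => [l0 ne0|e]; last first.
  by apply: Qext Qk => l; apply/eqP; rewrite eq_sym -[_ == _]negbK e.
have [i nei mini] : exists2 i, (lam i : nat) != k i &
    forall l, (l < i)%N -> (lam l : nat) = k l.
  case: (@arg_minnP _ l0 (fun l => (lam l : nat) != k l) (fun l : 'I_n => l : nat) ne0) => i hi hmin; exists i => // l hl.
  by apply/eqP; apply: contraTT hl => hl; rewrite -leqNgt hmin.
have lti : (lam i < k i)%N.
  have := dom i.+1; rewrite /psum /wsum (bigD1 i) //= [leqRHS](bigD1 i) //=.
  rewrite (eq_bigr k) => [|l]; last first.
    by rewrite ltnS => /andP[h1]; rewrite -val_eqE => h2; apply: mini; rewrite ltn_neqAle h1 andbT.
  by rewrite leq_add2r leq_eqVlt (negbTE nei).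
have [j ltj minj] : exists2 j, (k j < lam j)%N &
    forall l, (l < j)%N -> (lam l <= k l)%N.
  have [j0 hj0] : exists j, (k j < lam j)%N.
    apply/existsP; rewrite -[[exists _, _]]negbK negb_exists; apply/negP => /forallP h.
    have : (\sum_l lam l < \sum_l k l)%N.
      rewrite (bigD1 i) //= [ltnRHS](bigD1 i) //= -addSn leq_add // leq_sum // => l _.
      by rewrite leqNgt h.
    by rewrite parts_sum sk ltnn.
  case: (@arg_minnP _ j0 (fun l => (k l < lam l)%N) (fun l : 'I_n => l : nat) hj0) => j hj hmin; exists j => // l hl.
  by rewrite leqNgt; apply: contraL hl => hl; rewrite -leqNgt hmin.
have ltij : (i < j)%N.
  rewrite ltnNge; apply/negP => h; move: h; rewrite leq_eqVlt => /predU1P[/val_inj e|h].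
    by move: ltj; rewrite e ltnNge (ltnW lti).
  by move: ltj; rewrite (mini _ h) ltnn.
have neij : i != j by rewrite -val_eqE neq_ltn ltij.
have kij : (k j < k i)%N.
  by rewrite (leq_trans ltj) // (leq_trans (parts_nonincr lam (ltnW ltij))) // ltnW.
have ki : (0 < k i)%N by apply: leq_ltn_trans kij.
have ks := wsum_move _ neij ki.
apply: (IH (move_weight k i j)); last exact: Qmove.
- apply: leq_trans hN.
  have lei (m : 'I_n.+1) : (wsum (move_weight k i j) m <= wsum k m)%N.
    rewrite -(leq_add2r (i < m)) ks leq_add2l; case: (ltnP j m) => // h.
    by rewrite (ltn_trans ltij h).
  rewrite (bigD1 (lift ord0 i)) //= [ltnRHS](bigD1 (lift ord0 i)) //= -addSn.
  apply: leq_add; last by apply: leq_sum.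
  have := ks (lift ord0 i); rewrite lift0 ltnS leqnn ltnS leqNgt ltij addn0 addn1.
  by move->.
- have full k' : wsum k' n = (\sum_l k' l)%N by apply: eq_bigl => l; rewrite ltn_ord.
  by have := ks n; rewrite !ltn_ord => /addIn; rewrite !full sk.
- move=> m; case: (leqP m i) => hi.
    by have := ks m; rewrite !ltnNge hi (leq_trans hi (ltnW ltij)) !addn0 => ->.
  case: (ltnP j m) => hj.
    by have := ks m; rewrite hi hj => /addIn ->.
  have := ks m; rewrite hi ltnNge hj addn0 addn1 => e.
  rewrite -ltnS e /psum /wsum (bigD1 i) //= [ltnRHS](bigD1 i) //= -addSn leq_add //.
  by apply: leq_sum => l /andP[h _]; apply: minj; apply: leq_trans hj.
Qed.
End Dominance.

Section Young.
Variables (R : realFieldType) (n : nat).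
Local Notation word := {ffun 'I_n -> 'I_n}.
Local Notation G := [set: 'S_n]%G.
Local Notation aG := (regular_repr R G).
Local Notation rW := (word_repr R n).
Implicit Types (lam mu nu : intpart n) (g p q t : 'S_n).

Definition row_sum m (rG : mx_representation R G m) mu : 'M[R]_m :=
  \sum_(p in row_group mu) rG p.
Definition col_sum m (rG : mx_representation R G m) mu : 'M[R]_m :=
  \sum_(q in col_group mu) (-1) ^+ (q : bool) *: rG q.

Lemma gring_mx_young m (rG : mx_representation R G m) mu :
  gring_mx rG (young_symmetrizer R mu) = col_sum rG mu *m row_sum rG mu.
Proof.
rewrite /young_symmetrizer exchange_big linear_sum mulmx_suml; apply: eq_bigr => q _.
rewrite linear_sum mulmx_sumr; apply: eq_bigr => p _ /=.
rewrite linearZ /= -scalemxAl; congr (_ *: _).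
by rewrite -repr_mxM ?inE // /gring_mx /= -rowE rowK mxvecK gring_indexK ?inE.
Qed.

Lemma row_groupE mu : row_group mu = word_stab (row_word mu).
Proof.
apply/setP => p; rewrite !inE; apply/forallP/word_act_fixP => h x.
  by apply: val_inj; rewrite /= !row_wordE; apply/eqP.
by rewrite -!row_wordE h.
Qed.

(** The row sum is the last factor of the symmetrizer, and it absorbs row
    permutations. *)
Lemma young_symmetrizer_row mu p : p \in row_group mu ->
  young_symmetrizer R mu *m aG p = young_symmetrizer R mu.
Proof.
move=> hp; rewrite -[X in X *m _](gring_mxK (young_symmetrizer R mu)).
rewrite -gring_row_mul gring_mx_young -mulmxA.
suff -> : row_sum aG mu *m aG p = row_sum aG mu by rewrite -gring_mx_young gring_mxK.
rewrite /row_sum mulmx_suml [RHS](reindex_inj (mulIg p)) /=.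
apply: eq_big => [g|g _]; last by rewrite repr_mxM ?inE.
by rewrite row_groupE in hp *; rewrite groupMr.
Qed.

(** Acting first by t leaves v unchanged but changes the sign of the column
    antisymmetrizer. *)
Lemma col_sum_kill m (rG : mx_representation R G m) mu (v : 'rV[R]_m) t :
  t \in col_group mu -> odd_perm t -> v *m rG t = v -> v *m col_sum rG mu = 0.
Proof.
move=> ht ot vt; apply/eqP.
(* The field has characteristic zero. *)
suff e : v *m col_sum rG mu = - (v *m col_sum rG mu).
  have : v *m col_sum rG mu *+ 2 == 0 by rewrite mulr2n {2}e subrr.
  by rewrite -scaler_nat scaler_eq0 Num.Theory.pnatr_eq0.
rewrite -{1}vt -mulmxA -mulmxN; congr (v *m _).
rewrite /col_sum mulmx_sumr -sumrN [RHS](reindex_inj (mulgI t)) /=.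
have colE x : tab_col mu (t x) = tab_col mu x.
  by move: ht; rewrite inE => /forallP/(_ x)/eqP.
apply: eq_big => [q|q _].
  rewrite !inE; apply/forallP/forallP => h x.
    by rewrite permM (eqP (h _)) colE.
  have := h (t^-1 x)%g; rewrite permM permKV => /eqP ->.
  by rewrite -[X in _ == tab_col mu X](permKV t x) colE.
rewrite -scalemxAr -repr_mxM ?inE // -scaleNr odd_permM ot.
by rewrite /= signrN opprK.
Qed.

(** Transpose two cells of a column that carry the same letter; they exist by
    [dominated_col_inj]. *)
Lemma col_collision nu mu (w : word) : has_content nu w -> ~~ dominated nu mu ->
  exists2 t, (t \in col_group mu) && odd_perm t & word_act w t = w.
Proof.
move=> hw nd.
have : exists xy : 'I_n * 'I_n,
    [&& xy.1 != xy.2, w xy.1 == w xy.2 & tab_col mu xy.1 == tab_col mu xy.2].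
  apply/existsP; apply: contraR nd; rewrite negb_exists => /forallP h.
  apply: (dominated_col_inj hw) => x y e1 e2; apply/eqP.
  by have := h (x, y); rewrite /= e1 e2 !eqxx !andbT negbK.
case=> -[x y] /= /and3P[ne /eqP ew /eqP ec].
exists (tperm x y); first rewrite odd_tperm ne andbT inE.
  by apply/forallP => z; case: tpermP => [->|->|]; rewrite ?ec.
by apply/eqP/word_act_fixP => z; case: tpermP => [->|->|].
Qed.

Lemma word_young_eq0 lam mu : ~~ dominated lam mu ->
  gring_mx rW (young_symmetrizer R mu) *m weight_mx R (fun i => lam i) = 0.
Proof.
move=> nd.
have -> : gring_mx rW (young_symmetrizer R mu) *m weight_mx R (fun i => lam i) =
    weight_mx R (fun i => lam i) *m gring_mx rW (young_symmetrizer R mu).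
  rewrite gring_mx_sum mulmx_suml mulmx_sumr; apply: eq_bigr => g _.
  by rewrite -scalemxAl -scalemxAr weight_mxC.
rewrite gring_mx_young mulmxA.
suff -> : weight_mx R (fun i => lam i) *m col_sum rW mu = 0 by rewrite mul0mx.
apply/row_matrixP => a; rewrite row_mul row0.
case: (boolP (has_content lam (enum_val a))) => [hw|nw]; last first.
  rewrite [row _ _](_ : _ = 0) ?mul0mx //; apply/rowP => b; rewrite !mxE.
  by rewrite (_ : has_weight _ _ = false) ?andbF //; apply: negbTE nw.
have -> : row a (weight_mx R (fun i => lam i)) = delta_mx 0 a.
  apply/rowP => b; rewrite !mxE eqxx /= (inj_eq enum_val_inj) eq_sym.
  by rewrite (_ : has_weight _ _ = true) ?andbT.
have [t /andP[tc ot] wt] := col_collision hw nd.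
apply: (col_sum_kill tc ot); rewrite -rowE; apply/rowP => b.
by rewrite !mxE eqxx wt (inj_eq enum_val_inj) eq_sym.
Qed.

(** c_nu g behaves like the row word of nu moved by g: every transposition that
    fixes this word also fixes c_nu g on the right.  Hence some column
    transposition of mu does, and c_nu g is killed by the column
    antisymmetrizer of mu. *)
Lemma specht_young_eq0 nu mu : ~~ dominated nu mu ->
  gring_mx (specht_repr R nu) (young_symmetrizer R mu) = 0.
Proof.
move=> nd; set c := young_symmetrizer R nu.
have kill (v : 'rV_#|G|) : (v <= specht_mx R nu)%MS ->
    v *m gring_mx aG (young_symmetrizer R mu) = 0.
  case/cyclic_mxP => A EA ->; rewrite -(gring_rowK EA) gring_mx_sum gring_mx_young.
  rewrite mulmx_sumr mulmx_suml big1 // => g _.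
  rewrite -scalemxAr -scalemxAl mulmxA.
  have hw : has_content nu (word_act (row_word nu) g).
    by rewrite has_content_word_act content_row_word.
  have [t /andP[tc ot] wt] := col_collision hw nd.
  rewrite (col_sum_kill tc ot) ?mul0mx ?scaler0 //.
  (* g t = (g t g^-1) g, and g t g^-1 is a row permutation of nu. *)
rewrite -mulmxA -repr_mxM ?inE // -(mulgKV g (g * t)%g) repr_mxM ?inE // mulmxA.
  rewrite young_symmetrizer_row // row_groupE inE.
  by rewrite !word_actM wt -!word_actM mulgV word_act1.
rewrite gring_mx_sum; apply/row_matrixP => i; rewrite row0.
apply: val_submod_inj; rewrite linear0.
rewrite rowE mulmx_sumr linear_sum /=.
rewrite -[RHS](kill (val_submod (delta_mx 0 i))) ?val_submodP // gring_mx_sum mulmx_sumr.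
apply: eq_bigr => g _; rewrite -!scalemxAr linearZ /=; congr (_ *: _).
exact: (val_submodJ (cyclic_mx_module aG _)).
Qed.

(** The letter-changing operator commutes with the symmetrizer and is injective,
    so it cannot send a nonzero image to zero. *)
Lemma word_young_step mu (k : 'I_n -> nat) i j : i != j -> (k j < k i)%N ->
  gring_mx rW (young_symmetrizer R mu) *m weight_mx R k != 0 ->
  gring_mx rW (young_symmetrizer R mu) *m weight_mx R (move_weight k i j) != 0.
Proof.
set C := gring_mx _ _ => ne lt; apply: contraNneq => h.
have CC (M : 'M[R]_#|{: word}|) : (forall g, M *m word_mx R g = word_mx R g *m M) -> M *m C = C *m M.
  move=> cM; rewrite /C gring_mx_sum mulmx_suml mulmx_sumr; apply: eq_bigr => g _.
  by rewrite -scalemxAl -scalemxAr cM.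
apply/eqP; apply: (move_mx_inj lt); first by rewrite -mulmxA weight_mx_idem.
rewrite -mulmxA weight_move // !mulmxA -(CC (weight_mx R k)); last by move=> g; rewrite weight_mxC.
rewrite -(mulmxA _ C) -(CC (move_mx R i j)); last by move=> g; rewrite move_mxC.
by rewrite -!mulmxA h !mulmx0.
Qed.

(** The coefficient of the row word in its own image is the order of the row
    group: only the identity is both a row and a column permutation. *)
Lemma word_young_diag mu :
  gring_mx rW (young_symmetrizer R mu) *m weight_mx R (fun i => mu i) != 0.
Proof.
set w0 := row_word mu; have hw : has_content mu w0 := content_row_word mu.
apply/eqP => /matrixP/(_ (enum_rank w0) (enum_rank w0)).
rewrite gring_mx_young /col_sum /row_sum mulmx_suml mulmx_suml summxE.
have entry p q : p \in row_group mu ->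
    (rW q *m rW p *m weight_mx R (fun i => mu i)) (enum_rank w0) (enum_rank w0) =
    (q \in row_group mu)%:R.
  have inG g : g \in G by rewrite inE.
  move=> hp; rewrite -repr_mxM ?inG // /= kernel_weight_mx kernel_mxE.
  rewrite (_ : has_weight _ _ = true) // mulr1 row_groupE -/w0.
  rewrite row_groupE -/w0 in hp.
  have -> : (word_act w0 (q * p)%g == w0) = ((q * p)%g \in word_stab w0) by rewrite inE.
  by rewrite groupMr.
have one_col : (1%g : 'S_n) \in col_group mu by rewrite inE; apply/forallP => x; rewrite perm1.
have one_row : (1%g : 'S_n) \in row_group mu by rewrite row_groupE group1.
rewrite (bigD1 (1%g : 'S_n)) //= [X in _ + X]big1 => [|q /andP[hq neq]].
  rewrite addr0 odd_perm1 expr0 scale1r mulmx_sumr mulmx_suml summxE.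
  rewrite (eq_bigr (fun=> 1)) => [|p hp]; last by rewrite entry // one_row.
  rewrite sumr_const mxE; apply/eqP; rewrite Num.Theory.pnatr_eq0 -lt0n card_gt0.
  by apply/set0Pn; exists 1%g.
rewrite mulmx_sumr mulmx_suml summxE big1 // => p hp.
rewrite -!scalemxAl mxE entry //.
suff -> : q \in row_group mu = false by rewrite mulr0.
apply: contraNF neq => hr; apply/eqP/permP => x; rewrite perm1.
apply: (@tab_inj _ mu); last by move: hq; rewrite inE => /forallP/(_ x)/eqP.
by move: hr; rewrite row_groupE inE => /word_act_fixP.
Qed.

Lemma word_young_neq0 lam mu : dominated lam mu ->
  gring_mx rW (young_symmetrizer R mu) *m weight_mx R (fun i => lam i) != 0.
Proof.
move=> /dominatedP dom.
pose Q k := gring_mx rW (young_symmetrizer R mu) *m weight_mx R k != 0.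
apply: (@dominance_ind n lam Q _ _ (fun l => mu l)).
- move=> k k' e; rewrite /Q (_ : weight_mx R k' = weight_mx R k) //.
  apply: eq_kernel_mx => w u; congr ((_ && _)%:R); apply: eq_forallb => i; by rewrite e.
- by move=> k i j ne lt; apply: word_young_step.
- exact: parts_sum.
- exact: dom.
- exact: word_young_diag.
Qed.

End Young.

(** * Orthogonality and completeness of the Specht characters *)

Section Characters.
Variables (R : realFieldType) (n : nat).
Local Notation G := [set: 'S_n]%G.
Implicit Types (lam mu nu alpha beta : intpart n) (g s : 'S_n).
Local Notation chi := (specht_char R).
Import Num.Theory.

Lemma specht_charJ mu g s : chi mu (g ^ s)%g = chi mu g.
Proof.
rewrite /specht_char /conjg !repr_mxM ?inE // mxtrace_mulC -mulmxA.
by rewrite -repr_mxM ?inE // mulgV repr_mx1 mulmx1.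
Qed.

(** A permutation is conjugate to its inverse, having the same cycles. *)
Lemma specht_charV mu g : chi mu g^-1%g = chi mu g.
Proof.
have [a ga] := cycle_class_ex g.
have [s ->] : exists s, (g^-1 = g ^ s)%g.
  by apply: (cycle_class_conj ga); rewrite cycle_classV.
exact: specht_charJ.
Qed.

Lemma specht_char_pairing_eq0 mu m (rG : mx_representation R G m) (M : 'M[R]_m) :
  M *m M = M -> (forall g, M *m rG g = rG g *m M) ->
  (\sum_g chi mu g * \tr (rG g *m M) == 0) =
  (gring_mx rG (young_symmetrizer R mu) *m M == 0).
Proof.
move=> idM cM; rewrite -cyclic_character_pairing_eq0 //.
congr (_ == 0); apply: eq_big => [g|g _]; first by rewrite inE.
by rewrite -specht_charV.
Qed.

(** Two distinct partitions cannot dominate each other, and the pairing is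
    symmetric, so [specht_young_eq0] applies in one of the two orders. *)
Lemma specht_char_orthogonal mu nu : mu != nu -> \sum_g chi mu g * chi nu g = 0.
Proof.
wlog nd : mu nu / ~~ dominated nu mu => [H ne|_].
  case: (boolP (dominated nu mu)) => d1; last exact: H.
  case: (boolP (dominated mu nu)) => d2; first by rewrite (dominated_anti d1 d2) eqxx in ne.
  rewrite -[RHS](H nu mu) //; last by rewrite eq_sym.
  by apply: eq_bigr => g _; rewrite mulrC.
have := @specht_char_pairing_eq0 mu _ (specht_repr R nu) 1%:M.
rewrite specht_young_eq0 // mul0mx eqxx mulmx1 => /(_ erefl).
move=> /(_ (fun g => etrans (mul1mx _) (esym (mulmx1 _)))) /eqP e; rewrite -[RHS]e.
by apply: eq_bigr => g _; rewrite mulmx1.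
Qed.

(** A weak form of Young's rule: chi^mu occurs in the permutation character on
    the words of content lam exactly when mu dominates lam. *)
Lemma nfixed_words_specht_char lam mu :
  (\sum_g chi mu g * (nfixed_words lam g)%:R != 0) = dominated lam mu.
Proof.
have := @specht_char_pairing_eq0 mu _ (word_repr R n) (weight_mx R (fun i => lam i)).
move=> /(_ (weight_mx_idem _ _) (weight_mxC _ _)).
have trE g : \tr (word_repr R n g *m weight_mx R (fun i => lam i)) = (nfixed_words lam g)%:R.
  rewrite [word_repr R n g]/(word_mx R g) kernel_weight_mx mxtrace_kernel /nfixed_words -sum1dep_card natr_sum.
  rewrite [RHS]big_mkcond /=; apply: eq_bigr => w _.
  by rewrite -natrM mulnb andbC [has_weight _ _]/(has_content lam w); case: ifP.
under eq_bigr => g _ do rewrite trE.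
move=> ->; case: (boolP (dominated lam mu)) => d; first exact: word_young_neq0.
by rewrite word_young_eq0 // eqxx.
Qed.

Lemma specht_degree_neq0 mu : (specht_degree R mu)%:R != 0 :> R.
Proof.
rewrite pnatr_eq0 mxrank_eq0 cyclic_mx_eq0; apply: contraTneq (dominated_refl mu) => c0.
by have := word_young_neq0 R (dominated_refl mu); rewrite c0 linear0 mul0mx eqxx.
Qed.

Lemma specht_char_norm_neq0 mu : \sum_g chi mu g * chi mu g != 0.
Proof.
rewrite psumr_neq0 => [|g _]; last by rewrite -expr2 sqr_ge0.
apply/hasP; exists 1%g; first exact: mem_index_enum.
rewrite /= -expr2 lt0r sqr_ge0 andbT sqrf_eq0 /specht_char repr_mx1 mxtrace1.
exact: specht_degree_neq0.
Qed.

Lemma sum_cycle_class (F : 'S_n -> R) : (forall g s, F (g ^ s)%g = F g) ->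
  \sum_g F g = \sum_alpha #|cycle_class alpha|%:R * F (repr (cycle_class alpha)).
Proof.
move=> FJ; transitivity (\sum_g \sum_(alpha | g \in cycle_class alpha) F g).
  apply: eq_bigr => g _; have [a ga] := cycle_class_ex g.
  rewrite (bigD1 a) //= big1 ?addr0 // => b /andP[gb].
  by rewrite (cycle_class_inj gb ga) eqxx.
rewrite (exchange_big_dep xpredT) //=; apply: eq_bigr => a _.
rewrite (eq_bigr (fun=> F (repr (cycle_class a)))) => [|g ga]; first by rewrite sumr_const mulr_natl.
by have [s ->] := cycle_class_conj (repr_cycle_class a) ga.
Qed.

Definition char_coef (f : 'S_n -> R) mu :=
  (\sum_g chi mu g * f g) / (\sum_g chi mu g * chi mu g).

(** The character table X is square, since classes and Specht characters are both
    indexed by the partitions of n.  Row orthogonality gives X a right inverse,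
    which is therefore a left inverse: this is column orthogonality. *)
Lemma class_function_expansion (f : 'S_n -> R) g : (forall g s, f (g ^ s)%g = f g) ->
  f g = \sum_mu char_coef f mu * chi mu g.
Proof.
move=> fJ; pose N mu := \sum_g chi mu g * chi mu g.
pose r alpha := repr (cycle_class alpha).
pose X := kernel_mx (fun mu alpha => chi mu (r alpha)).
pose Y := kernel_mx (fun alpha mu => #|cycle_class alpha|%:R * chi mu (r alpha) / N mu).
have XY : X *m Y = 1%:M.
  rewrite kernel_mxM; apply/matrixP => i j; rewrite !mxE -(inj_eq enum_val_inj).
  move: (enum_val i) (enum_val j) => mu nu.
  transitivity ((\sum_g chi mu g * chi nu g) / N nu).
    rewrite sum_cycle_class => [|h s]; last by rewrite !specht_charJ.
    by rewrite mulr_suml; apply: eq_bigr => a _; rewrite mulrA mulrCA.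
  case: eqP => [->|/eqP ne]; first by rewrite divff // specht_char_norm_neq0.
  by rewrite specht_char_orthogonal // mul0r.
have ortho2 a b : \sum_mu #|cycle_class a|%:R * chi mu (r a) / N mu * chi mu (r b) = (a == b)%:R.
  have := mulmx1C XY; rewrite kernel_mxM => /matrixP/(_ (enum_rank a) (enum_rank b)).
  by rewrite kernel_mxE mxE (inj_eq enum_rank_inj).
have [b gb] := cycle_class_ex g.
have rb (F : 'S_n -> R) : (forall g s, F (g ^ s)%g = F g) -> F g = F (r b).
  by move=> FJ; have [s ->] := cycle_class_conj (repr_cycle_class b) gb.
rewrite (rb f) //.
under eq_bigr => mu _ do rewrite (rb _ (specht_charJ mu)).
transitivity (\sum_a f (r a) * (a == b)%:R).
  rewrite (bigD1 b) //= eqxx mulr1 big1 ?addr0 // => a /negbTE ->.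
  by rewrite mulr0.
transitivity (\sum_a \sum_mu f (r a) *
    (#|cycle_class a|%:R * chi mu (r a) / N mu * chi mu (r b))).
  by apply: eq_bigr => a _; rewrite -mulr_sumr ortho2.
rewrite exchange_big /=; apply: eq_bigr => mu _.
rewrite /char_coef sum_cycle_class => [|h s]; last by rewrite specht_charJ fJ.
rewrite !mulr_suml; apply: eq_bigr => a _; rewrite !mulrA -/(N mu) -/(r a).
by congr (_ / _ * _); rewrite -mulrA mulrC.
Qed.
End Characters.

Section Main.
Variables (R : realType) (n : nat).
Implicit Types lam mu alpha : intpart n.
Import Num.Theory.

Definition class_coef lam alpha : R :=
  (nwords_per_young lam)%:R^-1 * (nfixed_words lam (repr (cycle_class alpha)))%:R.

Lemma class_coef_dominated lam alpha : ~~ dominated alpha lam -> class_coef lam alpha = 0.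
Proof.
move=> nd; rewrite /class_coef /nfixed_words (_ : [set w | _] = set0) ?cards0 ?mulr0 //.
apply/setP => w; rewrite !inE; apply: contraNF nd => /andP[hw /eqP fx].
exact: dominated_of_fix (repr_cycle_class alpha) hw fx.
Qed.

Lemma class_coef_diag_gt0 lam : 0 < class_coef lam lam.
Proof.
rewrite /class_coef mulr_gt0 ?invr_gt0 ?ltr0n ?nwords_per_young_gt0 //.
have [s ->] := cycle_class_conj (row_cycle_class lam) (repr_cycle_class lam).
rewrite nfixed_wordsJ /nfixed_words card_gt0; apply/set0Pn; exists (row_word lam).
by rewrite inE content_row_word row_cycle_fix eqxx.
Qed.

Lemma Cmx_dominated lam :
  Cmx R lam = \sum_(alpha | dominated alpha lam) class_coef lam alpha *: Aclass R alpha.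
Proof.
rewrite Cmx_class_sum [RHS]big_mkcond /=; apply: eq_bigr => a _.
by case: ifPn => // /class_coef_dominated; rewrite /class_coef => ->; rewrite scale0r.
Qed.

(** The entry of A_alpha at (g, 1) tells whether g has cycle type alpha. *)
Lemma Aclass_free : free [seq Aclass R alpha | alpha : intpart n].
Proof.
pose X := [tuple of [seq Aclass R alpha | alpha : intpart n]].
rewrite -[[seq _ | _ : _]]/(tval X); apply/freeP => k hk i.
pose a := enum_val i; pose g := repr (cycle_class a).
have Xi (j : 'I_#|{: intpart n}|) : X`_j = Aclass R (enum_val j) by rewrite nth_image.
move/matrixP: hk => /(_ (gring_index [set: 'S_n]%G g) (gring_index [set: 'S_n]%G 1%g)).
rewrite summxE (bigD1 i) //= big1 ?addr0 => [|j ne].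
  by rewrite Xi !mxE AclassE !gring_indexK ?in_setT // invg1 mulg1 repr_cycle_class mulr1.
rewrite Xi !mxE AclassE !gring_indexK ?in_setT // invg1 mulg1.
case: (boolP (g \in _)) => [h|]; last by rewrite mulr0.
by case/eqP: ne; apply: enum_val_inj; apply: (cycle_class_inj h (repr_cycle_class a)).
Qed.

(** Back substitution along the dominance order. *)
Lemma Aclass_in_span_Cmx alpha : Aclass R alpha \in <<[seq Cmx R lam | lam : intpart n]>>%VS.
Proof.
have [N] := ubnP #|[set beta | dominated beta alpha]|.
elim: N alpha => // N IH a; rewrite ltnS => hN.
have e : Aclass R a = (class_coef a a)^-1 *:
    (Cmx R a - \sum_(b | dominated b a && (b != a)) class_coef a b *: Aclass R b).
  rewrite Cmx_dominated (bigD1 a) ?dominated_refl //= addrK scalerA mulVf ?scale1r //.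
  by rewrite lt0r_neq0 // class_coef_diag_gt0.
rewrite e memvZ // rpredB //; first by apply: memv_span; apply: image_f.
apply: memv_suml => b /andP[d ne]; rewrite memvZ // IH //.
apply: leq_trans hN; apply: proper_card; apply/properP; split.
  by apply/subsetP => c; rewrite !inE => d'; apply: dominated_trans d' d.
exists a; rewrite !inE ?dominated_refl //.
by apply: contra ne => d'; rewrite (dominated_anti d d').
Qed.

Lemma Cmx_basis : basis_of (Aalg R n) [seq Cmx R lam | lam : intpart n].
Proof.
rewrite basisEdim; apply/andP; split.
  by apply/span_subvP => _ /imageP[a _ ->]; apply: Aclass_in_span_Cmx.
have /eqP -> : \dim (Aalg R n) == size [seq Aclass R alpha | alpha : intpart n].
  exact: Aclass_free.
by rewrite !size_map.
Qed.

(** The coefficient of chi^mu in the class function of C_lam, divided by the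
    normalization factor of E_mu. *)
Definition idem_coef lam mu : R :=
  char_coef (fun g => (nwords_per_young lam)%:R^-1 * (nfixed_words lam g)%:R) mu *
  ((specht_degree R mu)%:R / (n`!)%:R)^-1.

Lemma degree_ratio_neq0 mu : (specht_degree R mu)%:R / (n`!)%:R != 0 :> R.
Proof. by rewrite mulf_neq0 ?specht_degree_neq0 // invr_eq0 pnatr_eq0 -lt0n fact_gt0. Qed.

Lemma idem_coef_neq0 lam mu : (idem_coef lam mu != 0) = dominated lam mu.
Proof.
rewrite /idem_coef /char_coef !mulf_eq0 !invr_eq0 (negbTE (degree_ratio_neq0 mu)) orbF.
rewrite (negbTE (specht_char_norm_neq0 R mu)) orbF.
under eq_bigr => g _ do rewrite mulrCA.
rewrite -mulr_sumr mulf_eq0 invr_eq0 pnatr_eq0 eqn0Ngt nwords_per_young_gt0 /=.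
exact: nfixed_words_specht_char.
Qed.

Lemma Cmx_Emx lam :
  Cmx R lam = \sum_(mu | dominated lam mu) idem_coef lam mu *: Emx R mu.
Proof.
transitivity (\sum_mu idem_coef lam mu *: Emx R mu); last first.
  rewrite [RHS]big_mkcond /=; apply: eq_bigr => mu _.
  by rewrite -idem_coef_neq0; case: eqP => [->|]; rewrite ?scale0r.
rewrite Cmx_class_sum.
under eq_bigr => a _.
  rewrite (@class_function_expansion R n (fun g => (nwords_per_young lam)%:R^-1 * (nfixed_words lam g)%:R));
    last by move=> g s; rewrite nfixed_wordsJ.
  rewrite scaler_suml; over.
rewrite exchange_big /=; apply: eq_bigr => mu _.
rewrite /Emx scalerA mulfVK ?degree_ratio_neq0 // scaler_sumr.
by apply: eq_bigr => a _; rewrite scalerA.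
Qed.
End Main.

Theorem theorem10 (R : realType) (n : nat) (hn : (2 <= n)%N) :
  basis_of (Aalg R n) [seq Cmx R lam | lam : intpart n] /\
  (exists m : intpart n -> intpart n -> R,
     forall lam : intpart n,
       Cmx R lam = \sum_(alpha | dominated alpha lam) m lam alpha *: Aclass R alpha
       /\ 0 < m lam lam) /\
  (exists c : intpart n -> intpart n -> R,
     forall lam : intpart n,
       Cmx R lam = \sum_(mu | dominated lam mu) c lam mu *: Emx R mu
       /\ forall mu : intpart n, dominated lam mu -> c lam mu != 0).
Proof.
split; first exact: Cmx_basis.
split.
  exists (@class_coef R n) => lam; split; first exact: Cmx_dominated.
  exact: class_coef_diag_gt0.
exists (@idem_coef R n) => lam; split; first exact: Cmx_Emx.
by move=> mu; rewrite idem_coef_neq0.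
Qed.
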